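(* Let $\alpha:\mathscr{F}\to\mathscr{F}'$ be a strict homomorphism of frames, $\mathscr{F}=(S,I,R,\sigma,\sigma_1)$, $\mathscr{F}'=(S',I',R',\sigma',\sigma_1')$, that induces an isomorphism $R\cong R'$ and a surjection $S\to S'$ with kernel $\mathfrak{a}$. Assume there is a finite filtration $\mathfrak{a}=\mathfrak{a}_0\supseteq\mathfrak{a}_1\supseteq\cdots\supseteq\mathfrak{a}_n=0$ by ideals with $\sigma(\mathfrak{a}_i)\subseteq\mathfrak{a}_{i+1}$ and $\sigma_1(\mathfrak{a}_i)\subseteq\mathfrak{a}_i$, such that $\sigma_1$ is elementwise nilpotent on each $\mathfrak{a}_i/\mathfrak{a}_{i+1}$. Assume that finitely generated projective $S'$-modules lift to projective $S$-modules. Then $\alpha$ is crystalline, i.e. the base change functor $\alpha_*$ from windows over $\mathscr{F}$ to windows over $\mathscr{F}'$ is an equivalence of categories.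
   Context: Fix a prime $p$. For a ring endomorphism $\sigma$ of $S$ and an $S$-module $M$, $M^{(\sigma)}=S\otimes_{\sigma,S}M$; for a $\sigma$-linear map $g$, $g^\sharp$ is its linearisation. A frame is $\mathscr{F}=(S,I,R,\sigma,\sigma_1)$ with $S$ a ring, $I$ an ideal, $R=S/I$, $\sigma$ a ring endomorphism of $S$, $\sigma_1:I\to S$ a $\sigma$-linear map, such that: $I+pS\subseteq\mathrm{Rad}(S)$; $\sigma(a)\equiv a^p \bmod pS$ for all $a\in S$; $\sigma_1(I)$ generates $S$ as an $S$-module. A window over $\mathscr{F}$ is $(P,Q,F,F_1)$ with $P$ a finitely generated projective $S$-module, $Q\subseteq P$ a submodule, $F:P\to P$ and $F_1:Q\to P$ $\sigma$-linear, such that (1) $P=L\oplus T$ for some submodules with $Q=L\oplus IT$; (2) $F_1(ax)=\sigma_1(a)F(x)$ for $a\in I$, $x\in P$; (3) $F_1(Q)$ generates $P$. A homomorphism of windows over $\mathscr{F}$ is an $S$-linear $g:P\to P'$ with $g(Q)\subseteq Q'$, $F'g=gF$, $F_1'g=gF_1$. A homomorphism of frames $\alpha:\mathscr{F}\to\mathscr{F}'$ is a ring homomorphism $S\to S'$ with $\alpha(I)\subseteq I'$, $\sigma'\alpha=\alpha\sigma$ and $\sigma_1'\alpha=u\cdot\alpha\sigma_1$ for a unit $u\in S'$ (a $u$-homomorphism); it is strict if $u=1$. An $\alpha$-homomorphism of windows $\mathscr{P}\to\mathscr{P}'$ is an $S$-linear $g:P\to P'$ with $g(Q)\subseteq Q'$,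 $F'g=gF$, $F_1'g=u\cdot gF_1$. The base change $\alpha_*\mathscr{P}$ is the window over $\mathscr{F}'$ with an $\alpha$-homomorphism $\mathscr{P}\to\alpha_*\mathscr{P}$ inducing bijections $\mathrm{Hom}_{\mathscr{F}'}(\alpha_*\mathscr{P},\mathscr{P}')=\mathrm{Hom}_\alpha(\mathscr{P},\mathscr{P}')$ for all $\mathscr{F}'$-windows $\mathscr{P}'$ (it exists, with underlying module $S'\otimes_S P$). $\alpha$ is called crystalline if $\alpha_*$ is an equivalence of categories. *)

(* Defs.v *)
From HB Require Import structures.
From mathcomp Require Import all_boot all_order all_algebra.
Set Implicit Arguments. Unset Strict Implicit. Unset Printing Implicit Defensive.
Import GRing.Theory.
Local Open Scope ring_scope.

Section Basics.
Variable S : comPzRingType.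

Definition is_ideal (J : S -> Prop) : Prop :=
  [/\ J 0, (forall x y, J x -> J y -> J (x + y)) & (forall s x, J x -> J (s * x))].

Definition is_maximal_ideal (m : S -> Prop) : Prop :=
  [/\ is_ideal m, ~ m 1 &
      forall J, is_ideal J -> (forall x, m x -> J x) -> ~ J 1 -> forall x, J x -> m x].

Definition jacobson_rad (x : S) : Prop :=
  forall m, is_maximal_ideal m -> m x.

Definition is_submod (M : lmodType S) (N : M -> Prop) : Prop :=
  [/\ N 0, (forall x y, N x -> N y -> N (x + y)) & (forall s x, N x -> N (s *: x))].

Definition is_lin (M N : lmodType S) (f : M -> N) : Prop :=
  forall a x y, f (a *: x + y) = a *: f x + f y.

Definition fin_generated (M : lmodType S) : Prop :=
  exists n (g : 'I_n -> M), forall x, exists c : 'I_n -> S, x = \sum_(i < n) c i *: g i.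

Definition projective (P : lmodType S) : Prop :=
  forall (M N : lmodType S) (f : M -> N) (g : P -> N),
    is_lin f -> (forall y, exists x, f x = y) -> is_lin g ->
    exists h : P -> M, is_lin h /\ forall x, f (h x) = g x.

Definition fg_projective (P : lmodType S) : Prop := fin_generated P /\ projective P.

Definition ideal_mul_submod (M : lmodType S) (J : S -> Prop) (N : M -> Prop) (x : M) : Prop :=
  exists n (c : 'I_n -> S) (t : 'I_n -> M),
    (forall i, J (c i) /\ N (t i)) /\ x = \sum_(i < n) c i *: t i.
End Basics.

Definition semilin (S S' : comPzRingType) (phi : S -> S') (M : lmodType S) (N : lmodType S')
  (f : M -> N) : Prop :=
  forall a x y, f (a *: x + y) = phi a *: f x + f y.

(* semilinearity of a map only defined on a subset D (values outside D are irrelevant) *)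
Definition semilin_on (S S' : comPzRingType) (phi : S -> S') (M : lmodType S) (N : lmodType S')
  (D : M -> Prop) (f : M -> N) : Prop :=
  forall a x y, D x -> D y -> f (a *: x + y) = phi a *: f x + f y.

(* A frame (S, I, R = S/I, sigma, sigma1); sigma1 : I -> S is represented by a
   function S -> S whose values outside I are irrelevant. *)
Record frame (S : comPzRingType) := Frame {
  fI : S -> Prop;
  fsigma : {rmorphism S -> S};
  fsigma1 : S -> S }.

Definition is_frame (p : nat) (S : comPzRingType) (F : frame S) : Prop :=
  [/\ is_ideal (fI F),
      ((forall x y, fI F x -> fI F y -> fsigma1 F (x + y) = fsigma1 F x + fsigma1 F y) /\
       (forall s x, fI F x -> fsigma1 F (s * x) = fsigma F s * fsigma1 F x)),
      (forall x b, fI F x -> jacobson_rad (x + p%:R * b)),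
      (forall a, exists b, fsigma F a - a ^+ p = p%:R * b) &
      (forall s, exists n (c : 'I_n -> S) (x : 'I_n -> S),
          (forall i, fI F (x i)) /\ s = \sum_(i < n) c i * fsigma1 F (x i))].

Definition strict_frame_hom (S S' : comPzRingType) (F : frame S) (F' : frame S')
  (alpha : {rmorphism S -> S'}) : Prop :=
  [/\ forall a, fI F a -> fI F' (alpha a),
      forall a, fsigma F' (alpha a) = alpha (fsigma F a) &
      forall a, fI F a -> fsigma1 F' (alpha a) = alpha (fsigma1 F a)].

Definition window_axioms (S : comPzRingType) (F : frame S) (P : lmodType S)
  (Q : P -> Prop) (Fw F1 : P -> P) : Prop :=
  [/\ fg_projective P,
      semilin (fsigma F) Fw /\ semilin_on (fsigma F) Q F1,
      (exists L T : P -> Prop, [/\ is_submod L, is_submod T,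
          (forall x, exists l t, [/\ L l, T t & x = l + t]),
          (forall x, L x -> T x -> x = 0) &
          (forall x, Q x <-> exists l t, [/\ L l, ideal_mul_submod (fI F) T t & x = l + t])]),
      (forall a x, fI F a -> F1 (a *: x) = fsigma1 F a *: Fw x) &
      (forall x, exists n (c : 'I_n -> S) (q : 'I_n -> P),
          (forall i, Q (q i)) /\ x = \sum_(i < n) c i *: F1 (q i))].

(* F1 is only meaningful on Q: its values outside Q are junk and play no role. *)
Record window (S : comPzRingType) (F : frame S) := Window {
  wP : lmodType S;
  wQ : wP -> Prop;
  wF : wP -> wP;
  wF1 : wP -> wP;
  wax : window_axioms F wQ wF wF1 }.
Arguments wP {S F} w.
Arguments wQ {S F} w _.
Arguments wF {S F} w _.
Arguments wF1 {S F} w _.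

Definition is_whom (S : comPzRingType) (F : frame S) (P1 P2 : window F)
  (g : wP P1 -> wP P2) : Prop :=
  [/\ is_lin g,
      (forall x, wQ P1 x -> wQ P2 (g x)),
      (forall x, wF P2 (g x) = g (wF P1 x)) &
      (forall x, wQ P1 x -> wF1 P2 (g x) = g (wF1 P1 x))].

Definition is_ahom (S S' : comPzRingType) (F : frame S) (F' : frame S')
  (alpha : {rmorphism S -> S'}) (P : window F) (P' : window F')
  (g : wP P -> wP P') : Prop :=
  [/\ semilin alpha g,
      (forall x, wQ P x -> wQ P' (g x)),
      (forall x, wF P' (g x) = g (wF P x)) &
      (forall x, wQ P x -> wF1 P' (g x) = g (wF1 P x))].

(* (P', u) is a base change alpha_* P: u induces bijections
   Hom_{F'}(P', P'') = Hom_alpha(P, P''). *)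
Definition is_base_change (S S' : comPzRingType) (F : frame S) (F' : frame S')
  (alpha : {rmorphism S -> S'}) (P : window F) (P' : window F')
  (u : wP P -> wP P') : Prop :=
  is_ahom alpha u /\
  forall (P'' : window F') (v : wP P -> wP P''), is_ahom alpha v ->
    exists h : wP P' -> wP P'', [/\ is_whom h, (forall x, h (u x) = v x) &
      forall h', is_whom h' -> (forall x, h' (u x) = v x) -> forall y, h' y = h y].

Definition window_iso (S : comPzRingType) (F : frame S) (P1 P2 : window F) : Prop :=
  exists (f : wP P1 -> wP P2) (g : wP P2 -> wP P1),
    [/\ is_whom f, is_whom g, (forall x, g (f x) = x) & (forall y, f (g y) = y)].

(* alpha is crystalline: alpha_* is an equivalence of categories, i.e.
   - fully faithful: for base changes (P1', u1), (P2', u2) of P1, P2, the map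
     g |-> alpha_* g (the unique h with h o u1 = u2 o g) from Hom_F(P1,P2) to
     Hom_F'(P1',P2') is bijective;
   - essentially surjective: every F'-window is isomorphic to some alpha_* P. *)
Definition crystalline (S S' : comPzRingType) (F : frame S) (F' : frame S')
  (alpha : {rmorphism S -> S'}) : Prop :=
  (forall (P1 P2 : window F) (P1' P2' : window F')
          (u1 : wP P1 -> wP P1') (u2 : wP P2 -> wP P2'),
     is_base_change alpha u1 -> is_base_change alpha u2 ->
     forall h : wP P1' -> wP P2', is_whom h ->
       exists g : wP P1 -> wP P2, [/\ is_whom g, (forall x, h (u1 x) = u2 (g x)) &
         forall g', is_whom g' -> (forall x, h (u1 x) = u2 (g' x)) -> forall x, g' x = g x])
  /\
  (forall P' : window F', exists (P : window F) (P0' : window F') (u : wP P -> wP P0'),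
     is_base_change alpha u /\ window_iso P0' P').

(* base change of modules along alpha: (P', u) with u alpha-semilinear and
   universal, i.e. S' (x)_S P = P' via u. *)
Definition is_module_base_change (S S' : comPzRingType) (alpha : {rmorphism S -> S'})
  (P : lmodType S) (P' : lmodType S') (u : P -> P') : Prop :=
  semilin alpha u /\
  forall (M : lmodType S') (v : P -> M), semilin alpha v ->
    exists w : P' -> M, [/\ is_lin w, (forall x, w (u x) = v x) &
      forall w', is_lin w' -> (forall x, w' (u x) = v x) -> forall y, w' y = w y].

(* Main.v *)
(** Write a for the kernel of alpha. Since a lies in I, hence in the radical, the base change of a
   window P is P/aP, so full faithfulness says that a window homomorphism P1/aP1 -> P2/aP2 has a
   unique lift P1 -> P2. A normal decomposition P1 = L + T turns F1 and F into one sigma-linear map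
   Psi = F1 on L + F on T whose linearisation is bijective: it is onto, and modulo a maximal ideal,
   which contains p, sigma is the Frobenius, so source and target have the same rank. Hence the
   error of an arbitrary linear lift is corrected by solving w = U(w) + eta for linear
   w : P1 -> aP2, where U(w) is determined by U(w) Psi = (F1 w on L) + (F w on T). Modulo the next
   step of the filtration F w vanishes and F1(a x) = sigma1(a) F(x), so U is nilpotent on each w,
   which gives existence and uniqueness. For essential surjectivity, L' and T' are lifted
   separately, Psi' is lifted to their sum by projectivity, and F, F1 are read off from Psi;
   Nakayama's lemma shows that F1 still generates. The lifts L, T are only assumed projective: over
   a commutative ring a projective module which is finitely generated modulo an ideal in the
   radical is finitely generated, by the Cayley-Hamilton theorem. *)
Require Import Defs.
From HB Require Import structures.
From mathcomp Require Import all_boot all_order all_algebra.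
From mathcomp Require Import generic_quotient ring_quotient.
From mathcomp Require Import boolp classical_sets functions.
Set Implicit Arguments. Unset Strict Implicit. Unset Printing Implicit Defensive.
Import GRing.Theory.
Local Open Scope ring_scope.
Local Open Scope quotient_scope.

(** * Quotients *)

(** The subgroup is made a boolean predicate by classical logic, so that the library quotient
    applies; [r] picks representatives. *)
Lemma zmod_quotient (M : zmodType) (N : M -> Prop) :
  N 0 -> (forall x y, N x -> N y -> N (x - y)) ->
  exists (M' : zmodType) (q : {additive M -> M'}) (r : M' -> M),
    cancel r q /\ forall x, q x = 0 <-> N x.
Proof.
move=> N0 NB; pose I : pred M := fun x => `[<N x>].
have Icl : zmod_closed I.
  by split=> [|x y /asboolP Nx /asboolP Ny]; apply/asboolP => //; apply: NB.
pose cI := GRing.isZmodClosed.Build M I Icl.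
pose cIs : zmodClosed M := HB.pack_for (zmodClosed M) I cI.
exists (Quotient.quot cIs), (\pi_(Quotient.quot cIs)), (fun x => repr x).
split=> [x|x]; first exact: reprK.
rewrite -(raddf0 (\pi_(Quotient.quot cIs))).
split=> [/eqP|Nx]; last apply/eqP; rewrite -Quotient.idealrBE subr0.
  by move/asboolP.
exact/asboolP.
Qed.

(** A scalar of [S'] acts on M/N through any preimage in [S]; two preimages differ by an element of
    the kernel of [alpha], which maps M into N. For N = aM this gives the base change of M, for
    [alpha] the identity the usual quotient. *)
Lemma quotient_module (S S' : comPzRingType) (alpha : {rmorphism S -> S'})
    (M : lmodType S) (N : M -> Prop) :
  (forall s', exists s, alpha s = s') -> is_submod N ->
  (forall a x, alpha a = 0 -> N (a *: x)) ->
  exists (M' : lmodType S') (q : M -> M'), [/\ semilin alpha q,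
    (forall y, exists x, q x = y) & (forall x, q x = 0 <-> N x)].
Proof.
move=> surj [N0 ND NZ] Nker.
have NB x y : N x -> N y -> N (x - y).
  by move=> Nx Ny; apply: ND => //; rewrite -scaleN1r; apply: NZ.
have [[T cT] [q [r [qr qN]]]] := zmod_quotient N0 NB.
pose M' : zmodType := GRing.Zmodule.Pack cT.
have [l ll] := choice surj.
pose sc (s : S') (x : M') : M' := q (l s *: r x).
have qe x y : q x = q y <-> N (x - y).
  rewrite -qN raddfB; split=> [->|/eqP]; first by rewrite subrr.
  by rewrite subr_eq0 => /eqP.
have scq a x : sc (alpha a) (q x) = q (a *: x).
  rewrite /sc; apply/qe.
  have -> : l (alpha a) *: r (q x) - a *: x
    = (l (alpha a) - a) *: r (q x) + a *: (r (q x) - x).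
    by rewrite scalerBl scalerBr addrA subrK.
  apply: ND; first by apply: Nker; rewrite rmorphB ll subrr.
  by apply: NZ; apply/qe; rewrite qr.
have scA a b v : sc a (sc b v) = sc (a * b) v.
  by rewrite -(ll a) -(ll b) -(qr v) -rmorphM !scq scalerA.
have sc1 : left_id 1 sc.
  by move=> v; rewrite -{1}(qr v) -(rmorph1 alpha) scq scale1r qr.
have scD : right_distributive sc +%R.
  by move=> a u v; rewrite -(ll a) -(qr u) -(qr v) -raddfD !scq scalerDr raddfD.
have scDl v : {morph sc^~ v : a b / a + b}.
  by move=> a b /=; rewrite -(ll a) -(ll b) -rmorphD -(qr v) !scq scalerDl raddfD.
pose lm := GRing.Zmodule_isLmodule.Build S' M' scA sc1 scD scDl.
pose M'' : lmodType S' := HB.pack_for (lmodType S') T cT lm.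
exists M'', (q : M -> M''); split=> //.
- by move=> a x y; rewrite raddfD -scq.
- by move=> y; exists (r y).
Qed.

Lemma residue_field (S : comPzRingType) (m : S -> Prop) : is_maximal_ideal m ->
  exists (k : fieldType) (pi : {rmorphism S -> k}), forall x, pi x = 0 <-> m x.
Proof.
move=> [[m0 mD mM] m1 mmax].
have mB x y : m x -> m y -> m (x - y).
  by move=> Nx Ny; apply: mD => //; rewrite -mulN1r; apply: mM.
have [[T cT] [q [r [qr qN]]]] := zmod_quotient m0 mB.
pose k0 : zmodType := GRing.Zmodule.Pack cT.
have qe x y : q x = q y <-> m (x - y).
  rewrite -qN raddfB; split=> [->|/eqP]; first by rewrite subrr.
  by rewrite subr_eq0 => /eqP.
pose mu (x y : k0) : k0 := q (r x * r y).
have muq x y : mu (q x) (q y) = q (x * y).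
  apply/qe.
  have -> : r (q x) * r (q y) - x * y = r (q y) * (r (q x) - x) + x * (r (q y) - y).
    by rewrite !mulrBr addrA (mulrC (r _) x) subrK mulrC.
  by apply: mD; apply: mM; apply/qe; rewrite qr.
have muA : associative mu.
  by move=> x y z; rewrite -(qr x) -(qr y) -(qr z) !muq mulrA.
have muC : commutative mu.
  by move=> x y; rewrite -(qr x) -(qr y) !muq mulrC.
have mu1 : left_id (q 1) mu.
  by move=> x; rewrite -(qr x) !muq mul1r.
have muD : left_distributive mu +%R.
  by move=> x y z; rewrite -(qr x) -(qr y) -(qr z) -raddfD !muq mulrDl raddfD.
have q10 : q 1 != 0 by apply/eqP => /qN.
pose rm := GRing.Zmodule_isComNzRing.Build k0 muA muC mu1 muD q10.
pose k1 : comNzRingType := HB.pack_for comNzRingType T cT rm.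
have ex_inv (x : k1) : exists y : k1, x != 0 -> y * x = 1.
  have [->|x0] := eqVneq x 0; first by exists 0.
  (* The ideal generated by [m] and a representative of x. If it contains 1, the coefficient of
     [r x] gives an inverse; otherwise maximality puts [r x] into [m], so that x = 0. *)
  pose J s := exists a t, m a /\ s = a + t * r x.
  have [J1|nJ1] := pselect (J 1).
    case: J1 => a [t [ma e]]; exists (q t) => _.
    rewrite -[x in _ * x](qr x); change (mu (q t) (q (r x)) = q 1); rewrite muq.
    by apply/qe; rewrite e opprD addrA addrAC subrr sub0r -mulN1r; apply: mM.
  case/eqP: x0; rewrite -(qr x); apply/qN.
  apply: (mmax J) => //.
  - split.
    + by exists 0, 0; rewrite mul0r addr0.
    + move=> _ _ [a [t [ma ->]]] [b [t' [mb ->]]]; exists (a + b), (t + t').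
      by split; [exact: mD|rewrite mulrDl addrACA].
    + move=> s _ [a [t [ma ->]]]; exists (s * a), (s * t).
      by split; [exact: mM|rewrite mulrDr mulrA].
  - by move=> a ma; exists a, 0; rewrite mul0r addr0.
  - by exists 0, 1; rewrite mul1r add0r.
have [inv0 invP] := choice ex_inv.
pose inv (x : k1) : k1 := if x == 0 then 0 else inv0 x.
have mulV (x : k1) : x != 0 -> inv x * x = 1.
  by move=> x0; rewrite /inv (negPf x0); apply: invP.
have inv00 : inv 0 = 0 by rewrite /inv eqxx.
pose fm := GRing.ComNzRing_isField.Build k1 mulV inv00.
pose k : fieldType := HB.pack_for fieldType k1 fm.
have qmm : monoid_morphism (q : S -> k).
  by split=> // x y; change (q (x * y) = mu (q x) (q y)); rewrite muq.
have qam : zmod_morphism (q : S -> k) by exact: raddfB.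
pose qr1 := GRing.isMonoidMorphism.Build S k q qmm.
pose qr2 := GRing.isZmodMorphism.Build S k q qam.
pose pi : {rmorphism S -> k} := HB.pack_for {rmorphism S -> k} (q : S -> k) qr1 qr2.
by exists k, pi.
Qed.

(** * Units modulo the radical *)

(** Otherwise Zorn's lemma yields an ideal that is maximal among the proper ideals containing d, and
    this is a maximal ideal. *)
Lemma unit_avoiding_maximal (S : comPzRingType) (d : S) :
  (forall m, is_maximal_ideal m -> ~ m d) -> exists e, e * d = 1.
Proof.
move=> dm; apply/not_existsP => nu.
pose good (A : S -> Prop) := [/\ is_ideal A, A d & ~ A 1].
pose P : set (set S) := fun A => (forall x, ~ A x) \/ good A.
have [F FP Ftot|A [PA Amax]] := @Zorn_bigcup S P.
  have [[A [FA gA]]|nF] := pselect (exists A, F A /\ good A); last first.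
    left=> x [A FA Ax]; case: (FP A FA) => [/(_ x)//|gA].
    by apply: nF; exists A.
  have gd X : F X -> forall x, X x -> good X.
    by move=> /FP[nX x /nX//|].
  right; split; last by case=> X FX X1; have [_ _] := gd X FX 1 X1; apply.
  - split.
    + by exists A => //; case: gA => -[].
    + move=> x y [X FX Xx] [Y FY Yy].
      have [[_ XD _] _ _] := gd X FX x Xx; have [[_ YD _] _ _] := gd Y FY y Yy.
      case: (Ftot X Y FX FY) => [XY|YX].
        by exists Y => //; apply: YD => //; exact: XY.
      by exists X => //; apply: XD => //; exact: YX.
    + move=> s x [X FX Xx]; exists X => //.
      by have [[_ _ XM] _ _] := gd X FX x Xx; apply: XM.
  - by exists A => //; case: gA.
pose J0 : S -> Prop := fun x => exists t, x = t * d.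
have gJ0 : good J0.
  split.
  - split; first by exists 0; rewrite mul0r.
    + by move=> _ _ [a ->] [b ->]; exists (a + b); rewrite mulrDl.
    + by move=> s _ [a ->]; exists (s * a); rewrite mulrA.
  - by exists 1; rewrite mul1r.
  - by case=> t /esym /nu.
case: PA => [A0|[Ai Ad A1]].
  apply: (Amax J0); last by right.
  split=> [x /A0//|/(_ d) J0A]; apply: (A0 d); apply: J0A.
  by exists 1; rewrite mul1r.
apply: (dm A _ Ad); split=> // J Ji AJ J1 x Jx.
apply: contrapT => nAx; apply: (Amax J); last by right; split=> //; exact: AJ.
by split=> // JA; apply: nAx; exact: JA.
Qed.

(** The determinant of 1 - C is 1 modulo every maximal ideal, hence a unit, and the adjugate gives
    the inverse. *)
Lemma rad_inv_mx (S : comPzRingType) n (C : 'M[S]_n) :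
  (forall i j, jacobson_rad (C i j)) ->
  exists D : 'M[S]_n, D *m (1%:M - C) = 1%:M /\ (1%:M - C) *m D = 1%:M.
Proof.
move=> radC; have [e eE] : exists e, e * \det (1%:M - C) = 1.
  apply: unit_avoiding_maximal => m mm md.
  have [k [pi piE]] := residue_field mm.
  have /eqP := (piE _).2 md; rewrite -det_map_mx map_mxB map_mx1.
  have -> : map_mx pi C = 0.
    by apply/matrixP=> i j; rewrite !mxE; apply/piE; exact: radC.
  by rewrite subr0 det1 oner_eq0.
exists (e *: \adj (1%:M - C)).
by rewrite -scalemxAl -scalemxAr mul_adj_mx mul_mx_adj scale_scalar_mx eE.
Qed.

Lemma idempotent_rad_mx (S : comPzRingType) n (K : 'M[S]_n) :
  K *m K = K -> (forall i j, jacobson_rad (K i j)) -> K = 0.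
Proof.
move=> KK /rad_inv_mx[D [_ KD]].
by rewrite -[K]mulmx1 -KD mulmxA mulmxBr mulmx1 KK subrr mul0mx.
Qed.

Section StableInverse.
Let stable_inv_nz (R : comNzRingType) n (A D : 'M[R]_n) (W : 'rV[R]_n -> Prop) :
  W 0 -> (forall u v, W u -> W v -> W (u + v)) ->
  (forall a v, W v -> W (a *: v)) ->
  D *m A = 1%:M -> (forall v, W v -> W (v *m A)) ->
  forall v, W v -> W (v *m D).
Proof.
case: n A D W => [|n] A D W W0 WD WZ DA WA v Wv; first by rewrite thinmx0.
have WX i : W (v *m A ^+ i).
  elim: i => [|i IH]; first by rewrite expr0 mulmx1.
  by rewrite exprSr mulmxA; apply: WA.
have AD : A *m D = 1%:M := mulmx1C DA.
have CH := Cayley_Hamilton A.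
have szp : size (char_poly A) = n.+2 by rewrite size_char_poly.
(* Cayley-Hamilton with the constant term isolated; multiplied by D, it expresses a multiple of D as
   a polynomial in A. *)
have E : (char_poly A)`_0 *: (1 : 'M_n.+1) =
   - \sum_(i < n.+1) (char_poly A)`_i.+1 *: A ^+ i.+1.
  apply/eqP; rewrite -addr_eq0 -(expr0 A) -[X in _ == X]CH.
  rewrite -(big_ord_recl n.+1 (fun i : 'I_n.+2 => (char_poly A)`_i *: A ^+ i)).
  rewrite -szp -[X in _ == horner_mx A X]coefK poly_def linear_sum /=; apply/eqP.
  by apply: eq_bigr => i _; rewrite linearZ /= rmorphXn /= horner_mx_X.
have {}E : (char_poly A)`_0 *: D =
   - \sum_(i < n.+1) (char_poly A)`_i.+1 *: A ^+ i.
  rewrite -[D]mul1mx scalemxAl E mulNmx mulmx_suml; congr (- _).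
  apply: eq_bigr => i _; rewrite -scalemxAl exprSr; congr (_ *: _).
  by rewrite -mulmxA AD mulmx1.
(* The constant coefficient is the determinant of A up to sign, hence invertible. *)
have u0 : \det D * (-1) ^+ n.+1 * (char_poly A)`_0 = 1.
  rewrite char_poly_det mulrA -(mulrA (\det D)) -signr_odd -expr2 sqrr_sign mulr1.
  by rewrite -det_mulmx DA det1.
rewrite -[D]scale1r -u0 -scalerA E -scalemxAr mulmxN -scaleN1r scalerA.
apply: (WZ); rewrite mulmx_sumr.
by apply: (big_ind W) => // i _; rewrite -scalemxAr; apply: WZ.
Qed.

(* By Cayley-Hamilton the inverse of A is a polynomial in A. *)
Lemma stable_inv (S : comPzRingType) n (A D : 'M[S]_n) (W : 'rV[S]_n -> Prop) :
  W 0 -> (forall u v, W u -> W v -> W (u + v)) ->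
  (forall a v, W v -> W (a *: v)) ->
  D *m A = 1%:M -> (forall v, W v -> W (v *m A)) ->
  forall v, W v -> W (v *m D).
Proof.
(* Over the zero ring all vectors vanish; any other ring is repackaged as a nonzero ring. *)
have [S10|S10] := eqVneq (1 : S) 0.
  have z (u : 'rV[S]_n) : u = 0 by rewrite -[u]scale1r S10 scale0r.
  by move=> W0 _ _ _ _ v _; rewrite (z (v *m D)).
case: S S10 A D W => T cT S10.
pose nz := GRing.PzSemiRing_isNonZero.Build (GRing.ComPzRing.Pack cT) S10.
pose R : comNzRingType := HB.pack_for comNzRingType T cT nz.
exact: (@stable_inv_nz R n).
Qed.
End StableInverse.

(** * Finitely generated projective modules *)

Section SemilinearOn.
Variables (S S' : comPzRingType) (phi : {rmorphism S -> S'}).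
Variables (M : lmodType S) (N : lmodType S') (D : M -> Prop) (f : M -> N).
Hypotheses (subD : is_submod D) (fD : semilin_on phi D f).

Lemma semilin_on0 : f 0 = 0.
Proof.
have [D0 _ _] := subD; have := fD 1 D0 D0.
by rewrite scaler0 rmorph1 scale1r addr0 => /(congr1 (fun z => z - f 0)); rewrite addrK subrr.
Qed.

Lemma semilin_onD x y : D x -> D y -> f (x + y) = f x + f y.
Proof. by move=> Dx Dy; rewrite -{1}[x]scale1r fD // rmorph1 scale1r. Qed.

Lemma semilin_onZ a x : D x -> f (a *: x) = phi a *: f x.
Proof.
by have [D0 _ _] := subD => Dx; rewrite -[a *: x]addr0 fD // semilin_on0 addr0.
Qed.

Lemma semilin_onB x y : D x -> D y -> f (x - y) = f x - f y.
Proof.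
have [_ _ DZ] := subD => Dx Dy; rewrite -scaleN1r semilin_onD //; last exact: DZ.
by rewrite semilin_onZ // rmorphN1 scaleN1r.
Qed.

Lemma semilin_on_sum I (r : seq I) (P : pred I) (F : I -> M) :
  (forall i, P i -> D (F i)) -> f (\sum_(i <- r | P i) F i) = \sum_(i <- r | P i) f (F i).
Proof.
have [D0 DD _] := subD => DF.
have [//] : f (\sum_(i <- r | P i) F i) = \sum_(i <- r | P i) f (F i) /\
  D (\sum_(i <- r | P i) F i).
elim: r => [|i r [IH IHD]]; first by rewrite !big_nil; split=> //; apply: semilin_on0.
rewrite !big_cons; case: ifPn => // Pi; split; last by apply: DD; first exact: DF.
by rewrite semilin_onD ?IH //; exact: DF.
Qed.
End SemilinearOn.

Lemma submodT (S : comPzRingType) (M : lmodType S) : is_submod (fun _ : M => True).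
Proof. by []. Qed.

Section Semilinear.
Variables (S S' : comPzRingType) (phi : {rmorphism S -> S'}).
Variables (M : lmodType S) (N : lmodType S') (f : M -> N).
Hypothesis fl : semilin phi f.
Let fD : semilin_on phi (fun _ : M => True) f. Proof. by move=> a x y _ _. Qed.

Lemma semilin0 : f 0 = 0.
Proof. exact: semilin_on0 (submodT M) fD. Qed.
Lemma semilinD x y : f (x + y) = f x + f y.
Proof. exact: (semilin_onD fD I I). Qed.
Lemma semilinZ a x : f (a *: x) = phi a *: f x.
Proof. exact: (semilin_onZ (submodT M) fD _ I). Qed.
Lemma semilinB x y : f (x - y) = f x - f y.
Proof. exact: (semilin_onB (submodT M) fD I I). Qed.
Lemma semilin_sum I (r : seq I) (P : pred I) (F : I -> M) :
  f (\sum_(i <- r | P i) F i) = \sum_(i <- r | P i) f (F i).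
Proof. exact: (semilin_on_sum (submodT M) fD). Qed.
End Semilinear.

Section Linear.
Variables (S : comPzRingType) (M N : lmodType S) (f : M -> N).
Hypothesis fl : is_lin f.
Let fD : semilin (idfun : {rmorphism S -> S}) f. Proof. exact: fl. Qed.

Lemma lin0 : f 0 = 0. Proof. exact: semilin0 fD. Qed.
Lemma linD x y : f (x + y) = f x + f y. Proof. exact: semilinD fD _ _. Qed.
Lemma linZ a x : f (a *: x) = a *: f x. Proof. exact: semilinZ fD _ _. Qed.
Lemma linB x y : f (x - y) = f x - f y. Proof. exact: semilinB fD _ _. Qed.
Lemma lin_sum I (r : seq I) (P : pred I) (F : I -> M) :
  f (\sum_(i <- r | P i) F i) = \sum_(i <- r | P i) f (F i).
Proof. exact: (semilin_sum fD). Qed.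
End Linear.

(** Linear forms are stated with the ring product, so that their values lie in [S] rather than in
    the regular module [S^o]. *)
Definition functional (S : comPzRingType) (M : lmodType S) (f : M -> S) :=
  forall a x y, f (a *: x + y) = a * f x + f y.

Section Functional.
Variables (S : comPzRingType) (M : lmodType S) (f : M -> S).
Hypothesis ff : functional f.
Let fl : is_lin (f : M -> S^o). Proof. exact: ff. Qed.

Lemma functional0 : f 0 = 0. Proof. exact: lin0 fl. Qed.
Lemma functionalD x y : f (x + y) = f x + f y. Proof. exact: linD fl _ _. Qed.
Lemma functionalZ a x : f (a *: x) = a * f x. Proof. exact: linZ fl _ _. Qed.
Lemma functionalB x y : f (x - y) = f x - f y. Proof. exact: linB fl _ _. Qed.
Lemma functional_sum I (r : seq I) (P : pred I) (F : I -> M) :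
  f (\sum_(i <- r | P i) F i) = \sum_(i <- r | P i) f (F i).
Proof. exact: (lin_sum fl). Qed.
End Functional.

Lemma submodN (S : comPzRingType) (M : lmodType S) (W : M -> Prop) x :
  is_submod W -> W x -> W (- x).
Proof. by move=> [_ _ WZ] Wx; rewrite -scaleN1r; apply: WZ. Qed.

Lemma submodB (S : comPzRingType) (M : lmodType S) (W : M -> Prop) x y :
  is_submod W -> W x -> W y -> W (x - y).
Proof. by move=> sW Wx Wy; case: (sW) => _ WD _; apply: WD => //; apply: submodN. Qed.

Lemma submod_sum (S : comPzRingType) (M : lmodType S) (W : M -> Prop) I (r : seq I)
    (P : pred I) (F : I -> M) :
  is_submod W -> (forall i, P i -> W (F i)) -> W (\sum_(i <- r | P i) F i).
Proof. by move=> [W0 WD _] WF; apply: (big_ind W). Qed.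

Section Combinations.
Variables (S : comPzRingType) (M : lmodType S) (T : Type) (f : T -> M) (A : S -> T -> Prop).

(** Covers both the products J N, with [f] the identity, and the span of the image of a subset under
    [f], as in the generation axiom for F1. *)
Definition combination (x : M) := exists n (c : 'I_n -> S) (q : 'I_n -> T),
  (forall i, A (c i) (q i)) /\ x = \sum_(i < n) c i *: f (q i).

Lemma combination1 c t : A c t -> combination (c *: f t).
Proof. by move=> Act; exists 1, (fun=> c), (fun=> t); rewrite big_ord1. Qed.

Lemma combination_submod : (forall s c t, A c t -> A (s * c) t) -> is_submod combination.
Proof.
move=> AM; split.
(* [T] may be empty, so the elements indexing the empty sum are produced from a contradiction. *)
- have f0 (i : 'I_0) : False by case: i.
  by exists 0, (fun=> 0), (fun i => False_rect _ (f0 i)); split=> [[]//|]; rewrite big_ord0.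
- move=> _ _ [n1 [c1 [q1 [A1 ->]]]] [n2 [c2 [q2 [A2 ->]]]].
  exists (n1 + n2), (fun i => match fintype.split i with inl j => c1 j | inr j => c2 j end),
    (fun i => match fintype.split i with inl j => q1 j | inr j => q2 j end).
  split=> [i|]; first by case: fintype.split.
  rewrite big_split_ord; congr (_ + _); apply: eq_bigr => i _.
    by rewrite -[lshift _ _]/(unsplit (inl i)) unsplitK.
  by rewrite -[rshift _ _]/(unsplit (inr i)) unsplitK.
- move=> s _ [n1 [c1 [q1 [A1 ->]]]].
  exists n1, (fun i => s * c1 i), q1; split=> [i|]; first exact: AM.
  by rewrite scaler_sumr; apply: eq_bigr => i _; rewrite scalerA.
Qed.

Lemma combination_ind (W : M -> Prop) : is_submod W ->
  (forall c t, A c t -> W (c *: f t)) -> forall x, combination x -> W x.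
Proof. by move=> sW WA _ [n [c [q [Acq ->]]]]; apply: submod_sum => // i _; apply: WA. Qed.
End Combinations.

Notation imul J := (@ideal_mul_submod _ _ J (fun=> True)).

Section IdealMul.
Variables (S : comPzRingType) (J : S -> Prop).
Hypothesis idJ : is_ideal J.

Lemma ideal_mul_is_submod (M : lmodType S) (N : M -> Prop) : is_submod (ideal_mul_submod J N).
Proof.
apply: (@combination_submod _ _ _ id (fun c t => J c /\ N t)).
by case: idJ => _ _ JM s c t [Jc Nt]; split=> //; apply: JM.
Qed.

Lemma ideal_mul_scale (M : lmodType S) (N : M -> Prop) c x :
  J c -> N x -> ideal_mul_submod J N (c *: x).
Proof. by move=> Jc Nx; apply: (@combination1 _ _ _ id (fun c t => J c /\ N t)). Qed.

Lemma ideal_mul_ind (M : lmodType S) (N W : M -> Prop) : is_submod W ->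
  (forall c t, J c -> N t -> W (c *: t)) -> forall x, ideal_mul_submod J N x -> W x.
Proof.
move=> sW WA x; apply: (@combination_ind _ _ _ id (fun c t => J c /\ N t)) => //.
by move=> c t []; apply: WA.
Qed.

Lemma imul_lin (M N : lmodType S) (f : M -> N) x : is_lin f -> imul J x -> imul J (f x).
Proof.
move=> fl; have [I0 ID IZ] := ideal_mul_is_submod (fun _ : N => True).
apply: (ideal_mul_ind (W := fun x => imul J (f x))) => [|c t Jc _].
  split=> [|y z Wy Wz|s y Wy]; rewrite ?lin0 ?linD ?linZ //; [exact: ID|exact: IZ].
by rewrite linZ //; apply: ideal_mul_scale.
Qed.

Lemma imul_functional (M : lmodType S) (f : M -> S) x : functional f -> imul J x -> J (f x).
Proof.
move=> ff; have [J0 JD JM] := idJ.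
apply: (ideal_mul_ind (W := fun x => J (f x))) => [|c t Jc _].
  split=> [|y z Wy Wz|s y Wy]; rewrite ?functional0 ?functionalD ?functionalZ //.
    exact: JD.
  exact: JM.
by rewrite functionalZ // mulrC; apply: JM.
Qed.
End IdealMul.

(** * Free modules, coordinates and dual bases *)

Section FreeModule.
Variables (S : comPzRingType) (X : choiceType).

Definition finite_support : {pred X -> S^o} :=
  fun f => `[< exists s : seq X, forall x, x \notin s -> f x = 0 >].

Lemma finite_support_submod : submod_closed finite_support.
Proof.
split=> [|a f g /asboolP[s sP] /asboolP[t tP]]; apply/asboolP; first by exists [::].
exists (s ++ t) => x; rewrite mem_cat negb_or => /andP[xs xt].
by change (a * f x + g x = 0 :> S); rewrite sP // tP // mulr0 addr0.
Qed.

HB.instance Definition _ :=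
  GRing.isSubmodClosed.Build S (X -> S^o) finite_support finite_support_submod.

(** The free module on [X]. With [X] the underlying set of a module P it has a tautological
    surjection onto P, on which projectivity is tested. *)
Record freemod := FreeMod { freemod_val : X -> S^o; _ : freemod_val \in finite_support }.
HB.instance Definition _ := [isSub for freemod_val].
HB.instance Definition _ := [Choice of freemod by <:].
HB.instance Definition _ := [SubChoice_isSubLmodule of freemod by <:].
End FreeModule.

Lemma big_uniq_support (S : comPzRingType) (M : lmodType S) (X : choiceType)
    (F : X -> M) (s t : seq X) : uniq s -> uniq t -> {subset s <= t} ->
  (forall x, x \notin s -> F x = 0) -> \sum_(x <- s) F x = \sum_(x <- t) F x.
Proof.
move=> us ut st F0; rewrite [RHS](bigID (mem s)) /= [X in _ = _ + X]big1 // addr0.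
rewrite -[RHS]big_filter; apply: perm_big; apply: uniq_perm => //; first exact: filter_uniq.
by move=> x; rewrite mem_filter; case: (boolP (x \in s)) => //= /st ->.
Qed.

(** The dual basis lemma with all of P as generating family: a linear section of the tautological
    surjection from the free module on P supplies the coordinates. Sums may run over any finite set
    containing the support, so that several elements can share one set. *)
Lemma projective_coordinates (S : comPzRingType) (P : lmodType S) : projective P ->
  exists f : P -> P -> S, (forall x, functional (f x)) /\
    forall y, exists s : seq P, forall t, uniq t -> {subset s <= t} ->
      y = \sum_(x <- t) f x y *: x.
Proof.
move=> projP.
have ex_supp (h : freemod S P) : exists s : seq P, forall x, x \notin s -> freemod_val h x = 0.
  by case: h => h /= /asboolP.
have [supp suppP] := choice ex_supp.
pose ev (h : freemod S P) : P := \sum_(x <- undup (supp h)) freemod_val h x *: x.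
have evE h t : uniq t -> {subset supp h <= t} -> ev h = \sum_(x <- t) freemod_val h x *: x.
  move=> ut st; apply: big_uniq_support; rewrite ?undup_uniq // => x.
    by rewrite mem_undup; apply: st.
  by rewrite mem_undup => xs; rewrite suppP // scale0r.
have evl : is_lin ev.
  move=> a h k; pose t := undup (supp (a *: h + k) ++ supp h ++ supp k).
  have ut : uniq t by rewrite undup_uniq.
  rewrite (evE (a *: h + k) t) ?(evE h t) ?(evE k t) //; first last.
  - by move=> x xs; rewrite mem_undup mem_cat xs.
  - by move=> x xs; rewrite mem_undup !mem_cat xs orbT.
  - by move=> x xs; rewrite mem_undup !mem_cat xs !orbT.
  rewrite scaler_sumr -big_split; apply: eq_bigr => x _ /=.
  by rewrite scalerA -scalerDl.
have evs y : exists h, ev h = y.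
  pose d : P -> S^o := fun x => (x == y)%:R.
  have fd : d \in @finite_support S P.
    by apply/asboolP; exists [:: y] => x; rewrite inE /d => /negPf ->.
  exists (FreeMod fd); pose t := undup (y :: supp (FreeMod fd)).
  rewrite (evE _ t) ?undup_uniq //; last by move=> x xs; rewrite mem_undup inE xs orbT.
  rewrite (bigD1_seq y) ?undup_uniq ?mem_undup ?mem_head //= /d eqxx scale1r big1 ?addr0 //.
  by move=> x /negPf ->; rewrite scale0r.
have idl : is_lin (@id P) by [].
have [h [hl hE]] := projP _ _ ev id evl evs idl.
exists (fun x y => freemod_val (h y) x); split=> [x a y z|y]; first by rewrite hl.
by exists (supp (h y)) => t ut st; rewrite -evE.
Qed.

Definition dual_basis (S : comPzRingType) (P : lmodType S) r (g : 'I_r -> P) (f : 'I_r -> P -> S) :=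
  (forall i, functional (f i)) /\ forall x, x = \sum_(i < r) f i x *: g i.

Lemma fg_projective_dual_basis (S : comPzRingType) (P : lmodType S) : fg_projective P ->
  exists r (g : 'I_r -> P) (f : 'I_r -> P -> S), dual_basis g f.
Proof.
move=> [[n [g gen]] /projective_coordinates[f [ff /choice[sp spP]]]].
(* By linearity of the coordinates, the supports of the generators suffice for every x. *)
pose t := undup (flatten [seq sp (g i) | i <- enum 'I_n]).
exists (size t), (fun i => nth 0 t i), (fun i => f (nth 0 t i)); split=> // x.
have [c ->] := gen x.
rewrite -(big_mkord predT (fun i => f (nth 0 t i) (\sum_(i < n) c i *: g i) *: nth 0 t i)).
rewrite -(big_nth 0 predT (fun y => f y (\sum_(i < n) c i *: g i) *: y)).
rewrite [RHS](eq_bigr (fun y => \sum_(i < n) (c i * f y (g i)) *: y)); last first.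
  move=> y _; rewrite functional_sum // scaler_suml.
  by apply: eq_bigr => i _; rewrite functionalZ.
rewrite exchange_big; apply: eq_bigr => i _ /=.
rewrite {1}(spP (g i) t) ?undup_uniq //.
  by rewrite scaler_sumr; apply: eq_bigr => y _; rewrite scalerA.
move=> y ys; rewrite mem_undup; apply/flatten_mapP; exists i => //.
by rewrite mem_enum.
Qed.

Lemma dual_basis_fg_projective (S : comPzRingType) (P : lmodType S) r
    (g : 'I_r -> P) (f : 'I_r -> P -> S) : dual_basis g f -> fg_projective P.
Proof.
move=> [ff fg]; split; first by exists r, g => x; exists (fun i => f i x); exact: fg.
move=> M N q h ql qs hl.
have [l lP] := choice (fun i => qs (h (g i))).
exists (fun x => \sum_(i < r) f i x *: l i); split=> [a x y|x].
  rewrite scaler_sumr -big_split; apply: eq_bigr => i _ /=.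
  by rewrite ff scalerDl scalerA.
rewrite lin_sum // {2}(fg x) (lin_sum hl); apply: eq_bigr => i _.
by rewrite !linZ // lP.
Qed.

(* Fix finitely many coordinates t1 on which the generators mod J are supported; the
   corresponding truncation tau is the identity mod J. On the elements supported in a finite
   t2 containing the supports of y and of t1, tau acts on coordinates by a matrix 1 - C with C
   in J; its inverse is a polynomial in it, so that y lies in the image of tau. *)
Lemma projective_fg_mod_rad (S : comPzRingType) (J : S -> Prop) (P : lmodType S) r (m : 'I_r -> P) :
  is_ideal J -> (forall x, J x -> jacobson_rad x) -> projective P ->
  (forall x, exists c : 'I_r -> S, imul J (x - \sum_(i < r) c i *: m i)) ->
  fin_generated P.
Proof.
move=> idJ Jrad /projective_coordinates[f [ff /choice[sp spP]]] gen.
pose t1 := undup (flatten [seq sp (m i) | i <- enum 'I_r]).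
pose tau y := \sum_(x <- t1) f x y *: x.
have taul : is_lin tau.
  move=> a y z; rewrite /tau scaler_sumr -big_split; apply: eq_bigr => x _ /=.
  by rewrite ff scalerDl scalerA.
have taum i : tau (m i) = m i.
  rewrite /tau -(spP (m i) t1) ?undup_uniq // => x xs; rewrite mem_undup.
  by apply/flatten_mapP; exists i => //; rewrite mem_enum.
pose psi y := y - tau y.
have psil : is_lin psi.
  by move=> a y z; rewrite /psi taul scalerBr opprD addrACA.
have psiJ y : imul J (psi y).
  have [c cP] := gen y; rewrite -(subrK (\sum_(i < r) c i *: m i) y) (linD psil).
  rewrite [psi (\sum_(i < r) _)](lin_sum psil) [X in _ + X]big1 ?addr0; first exact: imul_lin.
  by move=> i _; rewrite (linZ psil) /psi taum subrr scaler0.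
pose W y := exists c : 'I_(size t1) -> S, y = \sum_(i < size t1) c i *: nth 0 t1 i.
have sW : is_submod W.
  split; first by exists (fun=> 0); rewrite big1 // => i _; rewrite scale0r.
    move=> _ _ [c ->] [d ->]; exists (fun i => c i + d i); rewrite -big_split.
    by apply: eq_bigr => i _; rewrite scalerDl.
  move=> s _ [c ->]; exists (fun i => s * c i); rewrite scaler_sumr.
  by apply: eq_bigr => i _; rewrite scalerA.
have Wtau y : W (tau y).
  by exists (fun i => f (nth 0 t1 i) y); rewrite /tau (big_nth 0) big_mkord.
exists (size t1), (fun i => nth 0 t1 i) => y.
pose t2 := undup (t1 ++ sp y ++ flatten (map sp t1)).
pose b (i : 'I_(size t2)) := nth 0 t2 i.
pose tau2 z := \sum_i f (b i) z *: b i.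
have tau2E z : tau2 z = \sum_(x <- t2) f x z *: x by rewrite (big_nth 0) big_mkord.
have tau2l : is_lin tau2.
  move=> a u z; rewrite /tau2 scaler_sumr -big_split; apply: eq_bigr => x _ /=.
  by rewrite ff scalerDl scalerA.
have t2y : tau2 y = y.
  rewrite tau2E -spP ?undup_uniq // => x xs.
  by rewrite mem_undup !mem_cat xs orbT.
have t2tau z : tau2 (tau z) = tau z.
  rewrite /tau (lin_sum tau2l); apply: eq_big_seq => x xt1.
  rewrite (linZ tau2l) tau2E -spP ?undup_uniq // => u us.
  rewrite mem_undup !mem_cat; apply/orP; right; apply/orP; right.
  by apply/flatten_mapP; exists x.
pose C : 'M[S]_(size t2) := \matrix_(i, j) f (b j) (psi (b i)).
pose c z : 'rV[S]_(size t2) := \row_j f (b j) z.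
have cP z : tau2 z = z -> c z *m (1%:M - C) = c (tau z).
  move=> zE; rewrite mulmxBr mulmx1; apply/rowP => j; rewrite !mxE.
  have -> : tau z = z - psi z by rewrite /psi opprB addrC subrK.
  rewrite functionalB //; congr (_ - _).
  rewrite -{2}zE /tau2 (lin_sum psil) functional_sum //; apply: eq_bigr => i _.
  by rewrite !mxE (linZ psil) functionalZ.
have [D [DA AD]] : exists D, D *m (1%:M - C) = 1%:M /\ (1%:M - C) *m D = 1%:M.
  apply: rad_inv_mx => i j; rewrite mxE; apply: Jrad.
  exact: (imul_functional idJ (ff _) (psiJ _)).
have [W0 WD WZ] := sW.
(* Coordinate vectors of the elements of [W] supported on [t2]. They form a submodule stable under 1
   - C, which acts as [tau], hence under its inverse [D]; so c(y) = c(tau y) D lies in it. *)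
pose V v := exists z, [/\ tau2 z = z, W z & v = c z].
have cD u v : c (u + v) = c u + c v by apply/rowP => j; rewrite !mxE functionalD.
have cZ a v : c (a *: v) = a *: c v by apply/rowP => j; rewrite !mxE functionalZ.
have [|||||z [zE Wz yz]] := @stable_inv _ _ (1%:M - C) D V _ _ _ DA _ (c (tau y)).
- exists 0; split=> //; first exact: lin0.
  by apply/rowP => j; rewrite !mxE functional0.
- move=> _ _ [u [uE Wu ->]] [v [vE Wv ->]]; exists (u + v); split; last by rewrite cD.
    by rewrite linD // uE vE.
  exact: WD.
- move=> a _ [u [uE Wu ->]]; exists (a *: u); split; last by rewrite cZ.
    by rewrite linZ // uE.
  exact: WZ.
- move=> _ [u [uE Wu ->]]; exists (tau u); split=> //.
  by rewrite cP.
- by exists (tau y).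
- suff -> : y = z by [].
  rewrite -{1}t2y -zE /tau2; apply: eq_bigr => i _; congr (_ *: _).
  have := congr1 (fun v : 'rV_(size t2) => v 0 i) yz.
  by rewrite -cP // -mulmxA AD mulmx1 !mxE.
Qed.

(** * Semilinear maps lifting Frobenius *)

Section MatrixAction.
Variables (S : comPzRingType) (M : lmodType S) (r : nat).

Definition mxact (A : 'M[S]_r) (v : 'I_r -> M) (i : 'I_r) : M := \sum_(k < r) A i k *: v k.

Lemma mxactM A B v : mxact (A *m B) v =1 mxact A (mxact B v).
Proof.
move=> i; rewrite /mxact.
under eq_bigr => k _ do rewrite mxE scaler_suml.
rewrite exchange_big; apply: eq_bigr => j _ /=.
by rewrite scaler_sumr; apply: eq_bigr => k _; rewrite scalerA.
Qed.

Lemma eq_mxact A v w : v =1 w -> mxact A v =1 mxact A w.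
Proof. by move=> vw i; apply: eq_bigr => k _; rewrite vw. Qed.
End MatrixAction.

(** Right multiplication by Ps maps the row space of sE onto that of Ps, whose rank is at least that
    of E, hence that of sE. So it is injective there, while the rows of K lie in that space and are
    killed. *)
Lemma rank_injective_mx0 (k : fieldType) r (E sE Ps C K : 'M[k]_r) :
  \rank sE = \rank E -> C *m Ps = E -> sE *m Ps = Ps -> K *m sE = K -> K *m Ps = 0 -> K = 0.
Proof.
move=> rE CP sP Ks KP.
have /mxrank_injP/eqP cap0 : \rank (sE *m Ps) = \rank sE.
  apply/eqP; rewrite eqn_leq mxrankM_maxl sP rE -CP; exact: mxrankM_maxr.
apply/eqP; rewrite -submx0 -cap0 sub_capmx -{1}Ks submxMl.
exact/sub_kermxP.
Qed.

(** If m is sigma-linear and row i of C expresses g_i through the Psi(g_k), this is the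
    linearisation of m applied to a preimage of y under the linearisation of Psi. *)
Definition hat (S : comPzRingType) (P M : lmodType S) r (g : 'I_r -> P) (f : 'I_r -> P -> S)
    (C : 'M[S]_r) (m : P -> M) (y : P) : M :=
  \sum_(i < r) f i y *: mxact C (m \o g) i.

Section FrobeniusSemilinear.
Variables (p : nat) (S : comPzRingType) (sigma : {rmorphism S -> S}).
Hypotheses (p_prime : prime p) (p_rad : jacobson_rad (p%:R : S)).
Hypothesis sigmaX : forall a, exists b, sigma a - a ^+ p = p%:R * b.

(** Since p lies in [m], sigma induces the Frobenius of the residue field, and homomorphisms of
    fields preserve ranks. *)
Lemma frobenius_residue_rank m (k : fieldType) (pi : {rmorphism S -> k}) r (E : 'M[S]_r) :
  is_maximal_ideal m -> (forall x, pi x = 0 <-> m x) ->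
  \rank (map_mx pi (map_mx sigma E)) = \rank (map_mx pi E).
Proof.
move=> mm piE.
have chp : p \in [pchar k].
  by rewrite inE p_prime /=; apply/eqP; rewrite -(rmorph_nat pi); apply/piE; exact: p_rad.
rewrite -[RHS](mxrank_map (pFrobenius_aut chp)).
congr (\rank _); apply/matrixP => i j; rewrite !mxE.
rewrite [RHS](pFrobenius_autE chp) -rmorphXn; apply/eqP; rewrite -subr_eq0 -rmorphB; apply/eqP/piE.
have [b ->] := sigmaX (E i j).
by case: (mm) => -[_ _ mM] _ _; rewrite mulrC; apply: mM; exact: p_rad.
Qed.

(* The linearisation P^(sigma) -> P of a semilinear Psi with spanning image is a surjection of
   projective modules whose ranks agree modulo every maximal ideal, hence bijective; composing
   the linearisation of m with its inverse gives hat m. *)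
Lemma semilin_factor (P : lmodType S) r (g : 'I_r -> P) (f : 'I_r -> P -> S) (Psi : P -> P) :
  dual_basis g f -> semilin sigma Psi ->
  (forall W : P -> Prop, is_submod W -> (forall x, W (Psi x)) -> forall x, W x) ->
  exists C : 'M[S]_r, forall (M : lmodType S) (m : P -> M), semilin sigma m ->
    forall x, hat g f C m (Psi x) = m x.
Proof.
move=> [ff fg] Psil span.
pose W y := exists c : 'I_r -> S, y = \sum_(k < r) c k *: Psi (g k).
have sW : is_submod W.
  split; first by exists (fun=> 0); rewrite big1 // => i _; rewrite scale0r.
    move=> _ _ [c ->] [d ->]; exists (fun i => c i + d i); rewrite -big_split.
    by apply: eq_bigr => i _; rewrite scalerDl.
  move=> s _ [c ->]; exists (fun i => s * c i); rewrite scaler_sumr.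
  by apply: eq_bigr => i _; rewrite scalerA.
have semiE (M : lmodType S) (m : P -> M) x : semilin sigma m ->
    m x = \sum_(k < r) sigma (f k x) *: m (g k).
  move=> ml; rewrite {1}(fg x) (semilin_sum ml); apply: eq_bigr => k _.
  by rewrite (semilinZ ml).
have WP x : W (Psi x) by exists (fun k => sigma (f k x)); apply: semiE.
have [c cE] := choice (fun i => span W sW WP (g i)).
(* In coordinates, acting on row vectors: [E] and [sE] are the idempotents of P and P^(sigma), [Ps]
   is the linearisation of Psi, and [C] lifts the generators along it. *)
pose C : 'M[S]_r := \matrix_(i, k) c i k.
pose E : 'M[S]_r := \matrix_(i, k) f k (g i).
pose Ps : 'M[S]_r := \matrix_(i, k) f k (Psi (g i)).
pose sE := map_mx sigma E.
have fE k z : f k z = \sum_(l < r) f l z * f k (g l).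
  by rewrite {1}(fg z) functional_sum //; apply: eq_bigr => l _; rewrite functionalZ.
have CP : C *m Ps = E.
  apply/matrixP => i k; rewrite !mxE [in RHS](cE i) functional_sum //.
  by apply: eq_bigr => l _; rewrite !mxE functionalZ.
have PE : Ps *m E = Ps.
  by apply/matrixP => i k; rewrite !mxE [RHS]fE; apply: eq_bigr => l _; rewrite !mxE.
have EE : E *m E = E.
  by apply/matrixP => i k; rewrite !mxE [RHS]fE; apply: eq_bigr => l _; rewrite !mxE.
have sEE : sE *m sE = sE by rewrite -map_mxM EE.
have sEP : sE *m Ps = Ps.
  apply/matrixP => i k; rewrite !mxE [in RHS](semiE _ _ (g i) Psil) functional_sum //.
  by apply: eq_bigr => l _; rewrite !mxE functionalZ.
(* The projector of P^(sigma) onto the kernel of the linearised Psi. Equality of ranks makes it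
   vanish modulo every maximal ideal, and an idempotent with entries in the radical is zero. *)
pose K := sE - Ps *m C *m sE.
have KP : K *m Ps = 0.
  by rewrite /K mulmxBl -!mulmxA sEP CP PE subrr.
have KE : K *m sE = K by rewrite /K mulmxBl -[X in _ - X]mulmxA sEE.
have KK : K *m K = K.
  by rewrite {2}/K mulmxBr KE !mulmxA KP !mul0mx subr0.
have K0 : K = 0.
  apply: idempotent_rad_mx => // i j m mm.
  have [k [pi piE]] := residue_field mm.
  suff /matrixP/(_ i j) : map_mx pi K = 0 by rewrite !mxE => /piE.
  apply: (rank_injective_mx0 (Ps := map_mx pi Ps) (C := map_mx pi C)
    (frobenius_residue_rank E mm piE)); rewrite -map_mxM.
  - by rewrite CP.
  - by rewrite sEP.
  - by rewrite KE.
  - by rewrite KP map_mx0.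
have PCE : Ps *m C *m sE = sE by apply/esym/eqP; rewrite -subr_eq0 -/K K0.
exists C => M m ml x.
have mg : m \o g =1 mxact sE (m \o g).
  by move=> i; rewrite /= (semiE _ _ (g i) ml); apply: eq_bigr => k _; rewrite !mxE.
have main l : mxact Ps (mxact C (m \o g)) l = m (g l).
  rewrite -mxactM (eq_mxact _ mg) -mxactM PCE; exact/esym/mg.
rewrite (semiE _ _ x ml) /hat.
have fPsi i : f i (Psi x) = \sum_(l < r) sigma (f l x) * Ps l i.
  rewrite (semiE _ _ x Psil) functional_sum //.
  by apply: eq_bigr => l _; rewrite functionalZ // mxE.
under eq_bigr => i _ do rewrite fPsi scaler_suml.
rewrite exchange_big; apply: eq_bigr => l _ /=.
rewrite -main {2}/mxact scaler_sumr; apply: eq_bigr => i _.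
by rewrite scalerA.
Qed.
End FrobeniusSemilinear.

Section Hat.
Variables (S : comPzRingType) (P M : lmodType S) (r : nat) (g : 'I_r -> P) (f : 'I_r -> P -> S).
Variable (C : 'M[S]_r).
Hypothesis (ff : forall i, functional (f i)).

Lemma hat_lin (m : P -> M) : is_lin (hat g f C m).
Proof.
move=> a x y; rewrite /hat scaler_sumr -big_split; apply: eq_bigr => i _ /=.
by rewrite ff scalerDl scalerA.
Qed.

Lemma hat_submod (W : M -> Prop) (m : P -> M) :
  is_submod W -> (forall x, W (m x)) -> forall y, W (hat g f C m y).
Proof.
move=> sW Wm y; have [_ _ WZ] := sW.
apply: submod_sum => // i _; apply: (WZ); apply: submod_sum => // k _.
exact/WZ/Wm.
Qed.
End Hat.

(** * Windows *)

(** Encodes a normal decomposition by the idempotent with image L and kernel T; Q = L + IT then says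
    that x - e x lies in IP. *)
Definition normal_projection (S : comPzRingType) (I : S -> Prop) (P : lmodType S) (Q : P -> Prop)
    (e : P -> P) :=
  [/\ is_lin e, forall x, e (e x) = e x & forall x, Q x <-> imul I (x - e x)].

Definition normal_decomposition (S : comPzRingType) (I : S -> Prop) (P : lmodType S)
    (Q : P -> Prop) :=
  exists L T : P -> Prop, [/\ is_submod L, is_submod T,
    (forall x, exists l t, [/\ L l, T t & x = l + t]),
    (forall x, L x -> T x -> x = 0) &
    (forall x, Q x <-> exists l t, [/\ L l, ideal_mul_submod I T t & x = l + t])].

Section NormalDecomposition.
Variables (S : comPzRingType) (I : S -> Prop) (P : lmodType S) (Q : P -> Prop).
Hypothesis idI : is_ideal I.

Lemma normal_decomposition_projection :
  normal_decomposition I Q -> exists e, normal_projection I Q e.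
Proof.
move=> [L [T [sL sT LT LT0 QE]]].
have [_ LD LZ] := sL; have [_ TD TZ] := sT.
have [e eP] := choice LT.
have eL x : L (e x) by have [t []] := eP x.
have eT x : T (x - e x).
  by have [t [_ Tt xE]] := eP x; rewrite {1}xE addrC addKr.
have eE l t : L l -> T t -> e (l + t) = l.
  move=> Ll Tt; apply/eqP; rewrite -subr_eq0; apply/eqP/LT0.
    exact: submodB.
  have -> : e (l + t) - l = t - ((l + t) - e (l + t)).
    by rewrite opprB addrCA opprD (addrA t) addrAC subrr add0r [RHS]addrC addrC.
  exact: submodB.
have el : is_lin e.
  move=> a x y; rewrite -{1}(subrK (e x) x) -{1}(subrK (e y) y).
  have -> : a *: (x - e x + e x) + (y - e y + e y) =
      (a *: e x + e y) + (a *: (x - e x) + (y - e y)).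
    by rewrite scalerDr addrACA addrC.
  by apply: eE; [apply: LD => //; apply: LZ|apply: TD => //; apply: TZ].
have T0 t : T t -> e t = 0.
  by move=> Tt; rewrite -{1}(add0r t); apply: eE => //; case: sL.
have L1 l : L l -> e l = l.
  by move=> Ll; rewrite -{1}(addr0 l); apply: eE => //; case: sT.
exists e; split=> // [x|x]; first exact: L1.
split=> [/QE[l [t [Ll It ->]]]|].
  have Tt : T t by apply: (ideal_mul_ind sT) It => c u _; apply: TZ.
  rewrite eE // addrC addKr; apply: (ideal_mul_ind _ _ It); first exact: ideal_mul_is_submod.
  by move=> c u Ic _; apply: ideal_mul_scale.
move=> Ix; apply/QE; exists (e x), (x - e x); split=> //; last by rewrite addrC subrK.
(* Applying 1 - e once more turns a combination of arbitrary elements of P into one of elements of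
   T. *)
have -> : x - e x = (x - e x) - e (x - e x) by rewrite (T0 (x - e x)) ?subr0.
have sI := ideal_mul_is_submod idI T; have [I0 ID IZ] := sI.
apply: (ideal_mul_ind (W := fun z => ideal_mul_submod I T (z - e z))) Ix => [|c u Ic _].
  split; first by rewrite /= (lin0 el) subr0.
    by move=> y z Wy Wz; rewrite /= (linD el) opprD addrACA; apply: ID.
  by move=> s z Wz; rewrite /= (linZ el) -scalerBr; apply: IZ.
by rewrite /= (linZ el) -scalerBr; apply: ideal_mul_scale.
Qed.

Section Projection.
Variable e : P -> P.
Hypothesis eQ : normal_projection I Q e.
Let el : is_lin e. Proof. by case: eQ. Qed.
Let ee x : e (e x) = e x. Proof. by case: eQ. Qed.
Let QE x : Q x <-> imul I (x - e x). Proof. by case: eQ. Qed.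
Let sI : is_submod (imul I : P -> Prop). Proof. exact: ideal_mul_is_submod. Qed.

Lemma normal_Q_submod : is_submod Q.
Proof.
have [I0 ID IZ] := sI; split; first by apply/QE; rewrite /= (lin0 el) subr0.
  by move=> x y /QE Qx /QE Qy; apply/QE; rewrite /= (linD el) opprD addrACA; apply: ID.
by move=> s x /QE Qx; apply/QE; rewrite /= (linZ el) -scalerBr; apply: IZ.
Qed.

Lemma imul_normal_Q x : imul I x -> Q x.
Proof. by move=> Ix; apply/QE; apply: (submodB sI) => //; apply: (imul_lin idI el). Qed.

Lemma normal_Q_fix x : e x = x -> Q x.
Proof. by move=> ex; apply/QE; rewrite ex subrr; case: sI. Qed.

Lemma normal_compl x : e (x - e x) = 0.
Proof. by rewrite /= (linB el) ee subrr. Qed.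

(** Q is generated by L and the products a t. On these F1 is known: it is Psi on L, and F1(a t) =
    sigma1(a) Psi(t). *)
Lemma normal_Q_ind (W : P -> Prop) : is_submod W -> (forall x, e x = x -> W x) ->
  (forall a t, I a -> e t = 0 -> W (a *: t)) -> forall x, Q x -> W x.
Proof.
move=> sW W1 W2 x /QE Ix; have [W0 WD WZ] := sW.
rewrite -(subrK (e x) x); apply: (WD); last exact: W1.
have -> : x - e x = (x - e x) - e (x - e x) by rewrite normal_compl subr0.
apply: (ideal_mul_ind (W := fun z => W (z - e z))) Ix => [|c u Ic _].
  split; first by rewrite /= (lin0 el) subr0.
    by move=> y z Wy Wz; rewrite /= (linD el) opprD addrACA; apply: WD.
  by move=> s z Wz; rewrite /= (linZ el) -scalerBr; apply: WZ.
by rewrite /= (linZ el) -scalerBr; apply: W2 => //; apply: normal_compl.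
Qed.

Lemma projection_normal_decomposition : normal_decomposition I Q.
Proof.
exists (fun x => e x = x), (fun x => e x = 0); split.
- split; first exact: lin0.
    by move=> x y ex ey; rewrite /= (linD el) ex ey.
  by move=> s x ex; rewrite /= (linZ el) ex.
- split; first exact: lin0.
    by move=> x y ex ey; rewrite /= (linD el) ex ey addr0.
  by move=> s x ex; rewrite /= (linZ el) ex scaler0.
- by move=> x; exists (e x), (x - e x); rewrite normal_compl ee addrC subrK.
- by move=> x ->.
- have sT := ideal_mul_is_submod idI (fun x => e x = 0); have [T0 TD TZ] := sT.
  move=> x; split=> [Qx|[l [t [ex It ->]]]].
    apply: (normal_Q_ind (W := fun x => exists l t,
      [/\ e l = l, ideal_mul_submod I (fun x => e x = 0) t & x = l + t])) Qx.
    + split.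
      * by exists 0, 0; rewrite /= (lin0 el) addr0.
      * move=> _ _ [l [t [el1 It ->]]] [l' [t' [el1' It' ->]]]; exists (l + l'), (t + t').
        by rewrite /= (linD el) el1 el1' addrACA; split=> //; apply: TD.
      * move=> s _ [l [t [el1 It ->]]]; exists (s *: l), (s *: t).
        by rewrite /= (linZ el) el1 scalerDr; split=> //; apply: TZ.
    + by move=> y ey; exists y, 0; rewrite addr0.
    + move=> a t Ia et; exists 0, (a *: t); rewrite /= (lin0 el) add0r; split=> //.
      exact: ideal_mul_scale.
  have [_ QD _] := normal_Q_submod; apply: QD; first exact: normal_Q_fix.
  apply: imul_normal_Q; apply: (ideal_mul_ind _ _ It) => // c u Ic _.
  exact: ideal_mul_scale.
Qed.
End Projection.
End NormalDecomposition.

(** Write 1 as the sum of the c_i sigma1(a_i) and let theta be the sum of the c_i sigma(a_i).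
    Computing sigma1(a_i b) and F1(a_i x) in two ways gives both identities. They recover F on L
    from F1 when a window is lifted. *)
Lemma frame_theta p (S S' : comPzRingType) (F : frame S) (F' : frame S')
    (alpha : {rmorphism S -> S'}) :
  is_frame p F -> is_frame p F' -> strict_frame_hom F F' alpha ->
  exists theta, (forall a, fI F a -> fsigma F a = theta * fsigma1 F a) /\
    forall (P : window F') x, wQ P x -> wF P x = alpha theta *: wF1 P x.
Proof.
move=> [_ [_ s1Z] _ _ gen] [idI' _ _ _ _] [hI hs hs1]; have [n [c [a [Ia e1]]]] := gen 1.
exists (\sum_(i < n) c i * fsigma F (a i)); split.
  move=> b Ib; rewrite -[LHS]mulr1 e1 mulr_sumr mulr_suml; apply: eq_bigr => i _.
  by rewrite mulrCA -s1Z // mulrC -mulrA -s1Z // (mulrC b) mulrC.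
move=> P x Qx; have [_ [_ F1l] nd F1a _] := wax P.
have [e eQ] := normal_decomposition_projection idI' nd.
rewrite -[wF P x]scale1r -(rmorph1 alpha) e1 !rmorph_sum !scaler_suml; apply: eq_bigr => i _.
rewrite !rmorphM -!scalerA -hs1 // -F1a; last exact: hI.
by rewrite (semilin_onZ (normal_Q_submod idI' eQ) F1l) // hs.
Qed.

(** * The semilinear map Psi attached to a normal decomposition *)

Section WindowPsi.
Variables (p : nat) (S : comPzRingType) (F : frame S).
Hypothesis frF : is_frame p F.
Variable P : window F.

Let idI : is_ideal (fI F). Proof. by case: frF. Qed.

Lemma window_projection : exists e, normal_projection (fI F) (wQ P) e.
Proof. by have [_ _ nd _ _] := wax P; exact: normal_decomposition_projection. Qed.

Lemma window_Q_submod : is_submod (wQ P).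
Proof. by have [e eQ] := window_projection; exact: normal_Q_submod eQ. Qed.

Lemma window_imul_Q x : imul (fI F) x -> wQ P x.
Proof. by have [e eQ] := window_projection; exact: imul_normal_Q eQ _. Qed.

Lemma window_FE : semilin (fsigma F) (wF P).
Proof. by have [_ []] := wax P. Qed.

Lemma window_F1E : semilin_on (fsigma F) (wQ P) (wF1 P).
Proof. by have [_ []] := wax P. Qed.

Lemma window_F1Z a x : fI F a -> wF1 P (a *: x) = fsigma1 F a *: wF P x.
Proof. by have [_ _ _ F1a _] := wax P; apply: F1a. Qed.

Lemma window_span (W : wP P -> Prop) : is_submod W ->
  (forall x, wQ P x -> W (wF1 P x)) -> forall x, W x.
Proof.
move=> sW WF1 x; have [_ _ WZ] := sW; have [_ _ _ _ gen] := wax P.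
by have [n [c [q [Qq ->]]]] := gen x; apply: submod_sum => // i _; apply/WZ/WF1.
Qed.

Variable e : wP P -> wP P.
Hypothesis eQ : normal_projection (fI F) (wQ P) e.
Let el : is_lin e. Proof. by case: eQ. Qed.
Let ee x : e (e x) = e x. Proof. by case: eQ. Qed.
Let Qe x : wQ P (e x). Proof. exact: (normal_Q_fix idI eQ). Qed.

Definition wPsi x := wF1 P (e x) + wF P (x - e x).

Lemma wPsi_fix x : e x = x -> wPsi x = wF1 P x.
Proof. by move=> ex; rewrite /wPsi ex subrr (semilin0 window_FE) addr0. Qed.

Lemma wPsi_compl x : e x = 0 -> wPsi x = wF P x.
Proof.
by move=> ex; rewrite /wPsi ex subr0 (semilin_on0 window_Q_submod window_F1E) add0r.
Qed.

Lemma wPsi_semilin : semilin (fsigma F) wPsi.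
Proof.
move=> a x y; rewrite /wPsi el window_F1E // opprD addrACA -scalerBr window_FE.
by rewrite scalerDr addrACA.
Qed.

(** A submodule containing the image of Psi contains F1 of the generators of Q, hence F1(Q), which
    generates P. *)
Lemma wPsi_span (W : wP P -> Prop) : is_submod W ->
  (forall x, W (wPsi x)) -> forall x, W x.
Proof.
move=> sW WPsi; have [W0 WD WZ] := sW; apply: window_span => // q Qq.
have sQ := window_Q_submod; have [Q0 QD QZ] := sQ.
suff [] : wQ P q /\ W (wF1 P q) by [].
apply: (normal_Q_ind eQ (W := fun q => wQ P q /\ W (wF1 P q))) Qq.
- split; first by rewrite (semilin_on0 sQ window_F1E).
    move=> x y [Qx Wx] [Qy Wy]; split; first exact: QD.
    by rewrite (semilin_onD window_F1E) //; apply: WD.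
  move=> s x [Qx Wx]; split; first exact: QZ.
  by rewrite (semilin_onZ sQ window_F1E) //; apply: WZ.
- move=> x ex; split; first by rewrite -ex.
  by rewrite -wPsi_fix.
- move=> a t Ia et; split; first by apply: window_imul_Q; apply: ideal_mul_scale.
  by rewrite window_F1Z // -wPsi_compl //; apply: WZ.
Qed.
End WindowPsi.
Arguments window_FE {S F} P.
Arguments window_F1E {S F} P.

Section WindowHom.
Variables (p : nat) (S : comPzRingType) (F : frame S).
Hypothesis frF : is_frame p F.
Variables (P1 P2 : window F) (e : wP P1 -> wP P1).
Hypothesis eQ : normal_projection (fI F) (wQ P1) e.
Let idI : is_ideal (fI F). Proof. by case: frF. Qed.

(** Compatibility with F follows from that with F1, since sigma1(a) F(x) = F1(a x) and the sigma1(a)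
    generate the unit ideal. *)
Lemma whom_of_F1 (g : wP P1 -> wP P2) : is_lin g -> (forall x, wQ P1 x -> wQ P2 (g x)) ->
  (forall x, wQ P1 x -> wF1 P2 (g x) = g (wF1 P1 x)) -> is_whom g.
Proof.
move=> gl gQ gF1; split=> // x.
have [_ _ _ _ gen] := frF; have [n [c [a [Ia e1]]]] := gen 1.
rewrite -[LHS]scale1r -[wF P1 x]scale1r e1 !scaler_suml (lin_sum gl); apply: eq_bigr => i _.
rewrite -!scalerA (linZ gl) -!window_F1Z // -[a i *: g x](linZ gl) gF1 //.
by apply: (window_imul_Q frF); apply: ideal_mul_scale.
Qed.

(** Reduces the compatibilities to the single equation that is solved for lifts: on L it concerns
    F1, on T it concerns F, and L and IT generate Q. *)
Lemma whom_of_Psi (g : wP P1 -> wP P2) : is_lin g -> (forall x, wQ P1 x -> wQ P2 (g x)) ->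
  (forall x, g (wPsi e x) = wF1 P2 (g (e x)) + wF P2 (g (x - e x))) -> is_whom g.
Proof.
move=> gl gQ gPsi; apply: whom_of_F1 => // x Qx.
have sQ1 := window_Q_submod frF P1; have [Q0 QD QZ] := sQ1.
have sQ2 := window_Q_submod frF P2.
suff [] : wQ P1 x /\ wF1 P2 (g x) = g (wF1 P1 x) by [].
apply: (normal_Q_ind eQ (W := fun x => wQ P1 x /\ wF1 P2 (g x) = g (wF1 P1 x))) Qx.
- split.
  + rewrite (semilin_on0 sQ1 (window_F1E P1)) !(lin0 gl).
    by rewrite (semilin_on0 sQ2 (window_F1E P2)).
  + move=> y z [Qy Wy] [Qz Wz]; split; first exact: QD.
    rewrite (semilin_onD (window_F1E P1)) // !(linD gl).
    by rewrite (semilin_onD (window_F1E P2)) ?Wy ?Wz //; apply: gQ.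
  + move=> s y [Qy Wy]; split; first exact: QZ.
    rewrite (semilin_onZ sQ1 (window_F1E P1)) // !(linZ gl).
    by rewrite (semilin_onZ sQ2 (window_F1E P2)) ?Wy //; apply: gQ.
- move=> y ey; split; first exact: (normal_Q_fix idI eQ).
  by rewrite -(wPsi_fix ey) gPsi ey subrr (lin0 gl) (semilin0 (window_FE P2)) addr0.
- move=> a t Ia et; split; first by apply: (window_imul_Q frF); apply: ideal_mul_scale.
  rewrite window_F1Z // !(linZ gl) window_F1Z // -(wPsi_compl frF et) gPsi et subr0 (lin0 gl).
  by rewrite (semilin_on0 sQ2 (window_F1E P2)) add0r.
Qed.
End WindowHom.

(** * Base change along a surjection *)

Section BaseChange.
Variables (p : nat) (S S' : comPzRingType) (F : frame S) (F' : frame S').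
Variable alpha : {rmorphism S -> S'}.
Hypotheses (frF : is_frame p F) (frF' : is_frame p F') (hom : strict_frame_hom F F' alpha).
Hypothesis alphaI : forall s, fI F' (alpha s) -> fI F s.
Hypothesis alpha_surj : forall s', exists s, alpha s = s'.

Definition ker_ideal (x : S) := alpha x = 0.
Notation ka := ker_ideal.

Let idI : is_ideal (fI F). Proof. by case: frF. Qed.
Let idI' : is_ideal (fI F'). Proof. by case: frF'. Qed.

Lemma ker_is_ideal : is_ideal ka.
Proof.
rewrite /ka; split; first exact: rmorph0.
  by move=> x y kx ky; rewrite rmorphD kx ky addr0.
by move=> s x kx; rewrite rmorphM kx mulr0.
Qed.

Lemma ker_sub_I x : ka x -> fI F x.
Proof. by move=> kx; apply: alphaI; rewrite kx; case: idI'. Qed.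

Lemma imul_ker_I (P : lmodType S) (x : P) : imul ka x -> imul (fI F) x.
Proof.
apply: ideal_mul_ind; first exact: ideal_mul_is_submod.
by move=> c t /ker_sub_I Ic _; apply: ideal_mul_scale.
Qed.

Lemma ker_rad x : ka x -> jacobson_rad x.
Proof.
move=> /ker_sub_I Ix; have [_ _ rad _ _] := frF.
by have := rad x 0 Ix; rewrite mulr0 addr0.
Qed.

Lemma semilin_ker (P : lmodType S) (M : lmodType S') (v : P -> M) x :
  semilin alpha v -> imul ka x -> v x = 0.
Proof.
move=> vl; apply: (ideal_mul_ind (W := fun x => v x = 0)) => [|c t kc _].
  split=> [|y z|s y]; rewrite ?(semilin0 vl) ?(semilinD vl) ?(semilinZ vl) //.
    by move=> -> ->; rewrite addr0.
  by move=> ->; rewrite scaler0.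
by rewrite (semilinZ vl) kc scale0r.
Qed.

(** The explicit form of module base change: [u] identifies P' with P/aP. *)
Definition reduction (P : lmodType S) (P' : lmodType S') (u : P -> P') :=
  [/\ semilin alpha u, forall y, exists x, u x = y & forall x, u x = 0 -> imul ka x].

Lemma reduction_eq (P : lmodType S) (P' : lmodType S') (u : P -> P') (T : zmodType) (v : P -> T) :
  reduction u -> (forall x y, v (x - y) = v x - v y) -> (forall x, imul ka x -> v x = 0) ->
  forall x y, u x = u y -> v x = v y.
Proof.
move=> [ul _ uk] vB vk x y uxy; apply/eqP; rewrite -subr_eq0 -vB; apply/eqP/vk/uk.
by rewrite (semilinB ul) uxy subrr.
Qed.

Lemma reduction_section (P : lmodType S) (P' : lmodType S') (u : P -> P') :
  reduction u -> exists l, cancel l u.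
Proof. by move=> [_ us _]; have [l lP] := choice us; exists l. Qed.

(** Elements of I'P' lift to IP because the preimage of I' is I, and two lifts differ by an element
    of aP, which lies in IP. *)
Lemma reduction_imul (P : lmodType S) (P' : lmodType S') (u : P -> P') x :
  reduction u -> imul (fI F') (u x) <-> imul (fI F) x.
Proof.
move=> [ul us uk]; have [hI _ _] := hom.
have sI := ideal_mul_is_submod idI (fun _ : P => True).
have sI' := ideal_mul_is_submod idI' (fun _ : P' => True).
have [I0 ID IZ] := sI; have [I'0 I'D I'Z] := sI'; split.
  have lift y : imul (fI F') y -> exists2 z, imul (fI F) z & u z = y.
    apply: (ideal_mul_ind (W := fun y => exists2 z, imul (fI F) z & u z = y)).
      split; first by exists 0; rewrite ?(semilin0 ul).
        move=> _ _ [t It <-] [z Iz <-]; exists (t + z); last by rewrite (semilinD ul).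
        exact: ID.
      move=> s _ [t It <-]; have [a <-] := alpha_surj s; exists (a *: t).
        exact: IZ.
      by rewrite (semilinZ ul).
    move=> c t Ic _; have [a aE] := alpha_surj c; have [z <-] := us t.
    exists (a *: z); last by rewrite (semilinZ ul) aE.
    by apply: ideal_mul_scale => //; apply: alphaI; rewrite aE.
  move=> /lift[z Iz uz]; rewrite -(subrK z x); apply: ID => //.
  by apply/imul_ker_I/uk; rewrite (semilinB ul) uz subrr.
apply: (ideal_mul_ind (W := fun x => imul (fI F') (u x))) => [|c t Ic _].
  split=> [|y z Wy Wz|s y Wy]; rewrite ?(semilin0 ul) ?(semilinD ul) ?(semilinZ ul) //.
    exact: I'D.
  exact: I'Z.
by rewrite (semilinZ ul); apply: ideal_mul_scale => //; apply: hI.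
Qed.

(** Explicit model of the base change: P/aP, with Q' the image of Q. *)
Definition window_reduction (P : window F) (P' : window F') (u : wP P -> wP P') :=
  [/\ is_ahom alpha u, reduction u & forall y, wQ P' y -> exists2 x, wQ P x & u x = y].

Lemma window_reduction_base_change (P : window F) (P' : window F') (u : wP P -> wP P') :
  window_reduction u -> is_base_change alpha u.
Proof.
move=> [ua ur uQ]; split=> // P'' v [vl vQ vF vF1].
have [ul uQ' uF uF1] := ua; have [_ us uk] := ur.
have [l lP] := reduction_section ur.
have vE x y : u x = u y -> v x = v y.
  apply: (reduction_eq ur); first exact: (semilinB vl).
  by move=> z; apply: semilin_ker.
exists (v \o l); split=> [|x|h' [h'l _ _ _] h'u y].
- split.
  + move=> s y z /=; have [a <-] := alpha_surj s; rewrite -vl; apply: vE.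
    by rewrite ul !lP.
  + by move=> y /uQ[x Qx <-]; rewrite /= (vE _ x) ?lP //; apply: vQ.
  + by move=> y /=; rewrite vF; apply: vE; rewrite -uF !lP.
  + move=> y /uQ[x Qx <-] /=; rewrite (vE _ x) ?lP // vF1 //; apply: vE.
    by rewrite -uF1 // lP.
- by apply: vE; rewrite lP.
- by rewrite /= -h'u lP.
Qed.

Section Exists.
Variable P : window F.

Lemma imul_ker_F x : imul ka x -> imul ka (wF P x).
Proof.
have [kl0 klD klM] := ker_is_ideal; have [_ hs _] := hom.
have [I0 ID IZ] := ideal_mul_is_submod ker_is_ideal (fun _ : wP P => True).
apply: (ideal_mul_ind (W := fun x => imul ka (wF P x))) => [|c t kc _].
  split=> [|y z Wy Wz|s y Wy].
  - by rewrite (semilin0 (window_FE P)).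
  - by rewrite (semilinD (window_FE P)); apply: ID.
  - by rewrite (semilinZ (window_FE P)); apply: IZ.
rewrite (semilinZ (window_FE P)); apply: ideal_mul_scale => //.
by rewrite /ka -hs kc rmorph0.
Qed.

Lemma imul_ker_F1 x : imul ka x -> imul ka (wF1 P x).
Proof.
have sQ := window_Q_submod frF P; have [Q0 QD QZ] := sQ; have [_ _ hs1] := hom.
have [I0 ID IZ] := ideal_mul_is_submod ker_is_ideal (fun _ : wP P => True).
suff H : imul ka x -> wQ P x /\ imul ka (wF1 P x) by case/H.
apply: (ideal_mul_ind (W := fun x => wQ P x /\ imul ka (wF1 P x))) => [|c t kc _].
  split=> [|y z [Qy Wy] [Qz Wz]|s y [Qy Wy]].
  - by rewrite (semilin_on0 sQ (window_F1E P)).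
  - by rewrite (semilin_onD (window_F1E P)) //; split; [apply: QD|apply: ID].
  - by rewrite (semilin_onZ sQ (window_F1E P)) //; split; [apply: QZ|apply: IZ].
have Ic := ker_sub_I kc.
split; first by apply: (window_imul_Q frF); apply: ideal_mul_scale.
rewrite window_F1Z //; apply: ideal_mul_scale => //.
rewrite /ka -hs1 // kc; have [[I'0 _ _] [_ s1Z] _ _ _] := frF'.
by have := s1Z 0 0 I'0; rewrite mulr0 rmorph0 mul0r.
Qed.

(** F, F1, the projection and the dual basis descend to P/aP because F and F1 preserve aP, which
    lies in Q. They are transported through a set-theoretic section [l]. *)
Lemma window_reduction_exists :
  exists (P' : window F') (u : wP P -> wP P'), window_reduction u.
Proof.
have [hI hs hs1] := hom.
have sk : is_submod (imul ka : wP P -> Prop) := ideal_mul_is_submod ker_is_ideal _.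
have [M [u [ul us uk]]] : exists (M : lmodType S') (q : wP P -> M), [/\ semilin alpha q,
    (forall y, exists x, q x = y) & (forall x, q x = 0 <-> imul ka x)].
  by apply: quotient_module => // a x ax; apply: ideal_mul_scale.
have ur : reduction u by split=> // x /uk.
have [l lP] := reduction_section ur.
have sQ := window_Q_submod frF P; have [Q0 QD QZ] := sQ.
have [projP _ _ _ _] := wax P.
have [e eQ] := window_projection frF P; have [el ee QE] := eQ.
have [r [g [f db]]] := fg_projective_dual_basis projP; have [ff fg] := db.
have kerQ x : imul ka x -> wQ P x.
  by move=> kx; apply: (window_imul_Q frF); apply: imul_ker_I.
have lQ x : wQ P x -> wQ P (l (u x)).
  move=> Qx; rewrite -(subrK x (l (u x))); apply: QD => //; apply: kerQ.
  by apply/uk; rewrite (semilinB ul) lP subrr.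
have uFE x y : u x = u y -> u (wF P x) = u (wF P y).
  apply: (reduction_eq (v := fun x => u (wF P x)) ur).
    by move=> z t; rewrite (semilinB (window_FE P)) (semilinB ul).
  by move=> z kz; apply/uk/imul_ker_F.
have uF1E x y : wQ P x -> wQ P y -> u x = u y -> u (wF1 P x) = u (wF1 P y).
  move=> Qx Qy uxy; apply/eqP; rewrite -subr_eq0 -(semilinB ul).
  rewrite -(semilin_onB sQ (window_F1E P)) //; apply/eqP/uk/imul_ker_F1/uk.
  by rewrite (semilinB ul) uxy subrr.
have afE i x y : u x = u y -> alpha (f i x) = alpha (f i y).
  apply: (reduction_eq (v := fun x => alpha (f i x)) ur).
    by move=> z t; rewrite functionalB // rmorphB.
  by move=> z kz; apply: (imul_functional ker_is_ideal (ff i) kz).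
have ueE x y : u x = u y -> u (e x) = u (e y).
  apply: (reduction_eq (v := fun x => u (e x)) ur).
    by move=> z t; rewrite (linB el) (semilinB ul).
  by move=> z kz; apply/uk; apply: (imul_lin ker_is_ideal el).
pose Q' y := exists2 x, wQ P x & u x = y.
pose e' y := u (e (l y)).
pose Fw' y := u (wF P (l y)).
pose F1' y := u (wF1 P (l y)).
have F1u x : wQ P x -> F1' (u x) = u (wF1 P x).
  by move=> Qx; apply: uF1E => //; apply: lQ.
have Fu x : Fw' (u x) = u (wF P x) by apply: uFE; rewrite lP.
have eu x : e' (u x) = u (e x) by apply: ueE; rewrite lP.
have db' : dual_basis (fun i => u (g i)) (fun i y => alpha (f i (l y))).
  split=> [i s y z|y].
    have [a <-] := alpha_surj s; rewrite -rmorphM -rmorphD -ff; apply: afE.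
    by rewrite ul !lP.
  rewrite -{1}(lP y) {1}(fg (l y)) (semilin_sum ul); apply: eq_bigr => i _.
  by rewrite (semilinZ ul).
have eQ' : normal_projection (fI F') Q' e'.
  split.
  - move=> s y z; have [a <-] := alpha_surj s; rewrite /e' -ul -el; apply: ueE.
    by rewrite ul !lP.
  - by move=> y; rewrite -(lP y) !eu ee.
  - move=> y; split.
      by move=> [x /QE Qx <-]; rewrite eu -(semilinB ul); apply/(reduction_imul _ ur).
    move=> Iy; exists (l y); rewrite ?lP //; apply/QE/(reduction_imul _ ur).
    by rewrite (semilinB ul) lP.
have wax' : window_axioms F' Q' Fw' F1'.
  split.
  - exact: dual_basis_fg_projective db'.
  - split.
      move=> s y z; have [a <-] := alpha_surj s.
      by rewrite -(lP y) -(lP z) -ul !Fu window_FE ul hs.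
    move=> s _ _ [y Qy <-] [z Qz <-]; have [a <-] := alpha_surj s.
    rewrite -ul !F1u // ?window_F1E // ?ul ?hs //.
    by apply: (QD) => //; apply: QZ.
  - exact: projection_normal_decomposition eQ'.
  - move=> s y; have [a <-] := alpha_surj s => /alphaI Ia.
    rewrite -(lP y) -(semilinZ ul) F1u; last first.
      by apply: (window_imul_Q frF); apply: ideal_mul_scale.
    by rewrite window_F1Z // (semilinZ ul) Fu hs1.
  - pose W y := @combination _ M M F1' (fun (_ : S') q => Q' q) y.
    have sW : is_submod W by apply: combination_submod.
    have [W0 WD WZ] := sW.
    suff Wu x : W (u x) by move=> y; rewrite -(lP y); apply: Wu.
    apply: (window_span (W := fun x => W (u x))) => [|q Qq].
      split=> [|y z Wy Wz|s y Wy]; rewrite ?(semilin0 ul) ?(semilinD ul) ?(semilinZ ul) //.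
        exact: WD.
      exact: WZ.
    rewrite -F1u // -[F1' _]scale1r.
    by apply: (combination1 F1' (A := fun (_ : S') q => Q' q)); exists q.
exists (Window wax'), u; split=> //; split=> //=.
by move=> x Qx; exists x.
Qed.
End Exists.

(** Any base change is compared with the explicit one: the two universal maps satisfy h k = id by
    uniqueness, and surjectivity, kernel and image of Q are carried over. *)
Lemma base_change_window_reduction (P : window F) (P' : window F') (u : wP P -> wP P') :
  is_base_change alpha u -> window_reduction u.
Proof.
move=> [ua univ]; have [ul uQ uF uF1] := ua.
have [P0 [c cr]] := window_reduction_exists P.
have [ca [cl cs ck] cQ] := cr.
have [_ cuniv] := window_reduction_base_change cr.
have [k [[kl kQ kF kF1] ku _]] := univ _ _ ca.
have [h [[hl hQ hF hF1] hc _]] := cuniv _ _ ua.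
have [i [_ _ iuniq]] := univ _ _ ua.
have hk y : h (k y) = y.
  transitivity (i y); last by apply/esym; apply: (iuniq id).
  apply: (iuniq (h \o k)).
  - split.
    + by move=> a x z /=; rewrite kl hl.
    + by move=> x Qx /=; apply: hQ; apply: kQ.
    + by move=> x /=; rewrite hF kF.
    + by move=> x Qx /=; rewrite hF1 ?kF1 //; apply: kQ.
  - by move=> x /=; rewrite ku hc.
split=> //.
  split=> // [y|x ux]; last by apply: ck; rewrite -ku ux (lin0 kl).
  by have [x xE] := cs (k y); exists x; rewrite -hc xE hk.
move=> y Qy; have [x Qx xE] := cQ _ (kQ _ Qy).
by exists x => //; rewrite -hc xE hk.
Qed.
End BaseChange.

(** * Full faithfulness *)

Lemma imul_mono (S : comPzRingType) (J J' : S -> Prop) (P : lmodType S) (x : P) :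
  is_ideal J' -> (forall a, J a -> J' a) -> imul J x -> imul J' x.
Proof.
move=> idJ' JJ'; apply: ideal_mul_ind; first exact: ideal_mul_is_submod.
by move=> c t /JJ' Jc _; apply: ideal_mul_scale.
Qed.

Section FullyFaithful.
Variables (p : nat) (S S' : comPzRingType) (F : frame S) (F' : frame S').
Variable alpha : {rmorphism S -> S'}.
Variables (n : nat) (fa : nat -> S -> Prop).
Hypothesis p_prime : prime p.
Hypotheses (frF : is_frame p F) (frF' : is_frame p F') (hom : strict_frame_hom F F' alpha).
Hypothesis alphaI : forall s, fI F' (alpha s) -> fI F s.
Hypothesis fa0 : forall x, fa 0%N x <-> alpha x = 0.
Hypothesis fa_ideal : forall i, (i <= n)%N -> is_ideal (fa i).
Hypothesis fa_dec : forall i x, (i < n)%N -> fa i.+1 x -> fa i x.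
Hypothesis fan : forall x, fa n x <-> x = 0.
Hypothesis fa_sigma : forall i x, (i < n)%N -> fa i x -> fa i.+1 (fsigma F x).
Hypothesis fa_sigma1 : forall i x, (i <= n)%N -> fa i x -> fa i (fsigma1 F x).
Hypothesis fa_nilp : forall i x, (i < n)%N -> fa i x -> exists k, fa i.+1 (iter k (fsigma1 F) x).

Let idI : is_ideal (fI F). Proof. by case: frF. Qed.
Notation ka := (ker_ideal alpha).

Lemma fa_ker i x : (i <= n)%N -> fa i x -> ka x.
Proof.
elim: i x => [|i IH] x ile; first by move/fa0.
by move/fa_dec => /(_ ile); apply: IH; exact: ltnW.
Qed.

Lemma fa_I i x : (i <= n)%N -> fa i x -> fI F x.
Proof. by move=> ile /(fa_ker ile); apply: (ker_sub_I frF'). Qed.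

(** * Action of F and F1 along the filtration *)

Section Target.
Variable P2 : window F.
Let sQ := window_Q_submod frF P2.
Let sfa i (ile : (i <= n)%N) := ideal_mul_is_submod (fa_ideal ile) (fun _ : wP P2 => True).

Lemma imul_fa_ker i (z : wP P2) : (i <= n)%N -> imul (fa i) z -> imul ka z.
Proof. by move=> ile; apply: (imul_mono (ker_is_ideal alpha)) => a; apply: fa_ker. Qed.

Lemma imul_ker_Q (z : wP P2) : imul ka z -> wQ P2 z.
Proof. by move=> kz; apply: (window_imul_Q frF); apply: (imul_ker_I frF frF' alphaI). Qed.

Lemma imul_fa_F i (z : wP P2) : (i < n)%N -> imul (fa i) z -> imul (fa i.+1) (wF P2 z).
Proof.
move=> iln; have [I0 ID IZ] := sfa iln.
apply: (ideal_mul_ind (W := fun z => imul (fa i.+1) (wF P2 z))) => [|c t Ac _].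
  split=> [|y y' Wy Wy'|s y Wy].
  - by rewrite (semilin0 (window_FE P2)).
  - by rewrite (semilinD (window_FE P2)); apply: ID.
  - by rewrite (semilinZ (window_FE P2)); apply: IZ.
by rewrite (semilinZ (window_FE P2)); apply: ideal_mul_scale => //; apply: fa_sigma.
Qed.

Lemma imul_fa_F_le i (z : wP P2) : (i <= n)%N -> imul (fa i) z -> imul (fa i) (wF P2 z).
Proof.
(* For i = n there is no next ideal, but then z = 0. *)
rewrite leq_eqVlt => /orP[/eqP -> Az|iln Az].
  have -> : z = 0.
    apply: (ideal_mul_ind (W := fun z => z = 0)) Az => [|c t /fan -> _]; last by rewrite scale0r.
    by split=> // [x y -> ->|s x ->]; rewrite ?addr0 ?scaler0.
  by rewrite (semilin0 (window_FE P2)); case: (sfa (leqnn n)).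
by apply: (imul_mono (fa_ideal (ltnW iln)) _ (imul_fa_F iln Az)) => a; apply: fa_dec.
Qed.

Lemma imul_fa_F1 i (z : wP P2) : (i <= n)%N -> imul (fa i) z -> imul (fa i) (wF1 P2 z).
Proof.
move=> ile Az; have [Q0 QD QZ] := sQ; have [I0 ID IZ] := sfa ile.
suff [] : wQ P2 z /\ imul (fa i) (wF1 P2 z) by [].
apply: (ideal_mul_ind (W := fun x => wQ P2 x /\ imul (fa i) (wF1 P2 x))) Az => [|c t Ac _].
  split=> [|y y' [Qy Wy] [Qy' Wy']|s y [Qy Wy]].
  - by rewrite (semilin_on0 sQ (window_F1E P2)).
  - by rewrite (semilin_onD (window_F1E P2)) //; split; [apply: QD|apply: ID].
  - by rewrite (semilin_onZ sQ (window_F1E P2)) //; split; [apply: QZ|apply: IZ].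
have Ic := fa_I ile Ac.
split; first by apply: (window_imul_Q frF); apply: ideal_mul_scale.
by rewrite window_F1Z //; apply: ideal_mul_scale => //; apply: fa_sigma1.
Qed.

Lemma iter_imul_fa_F1 i k (z : wP P2) : (i <= n)%N ->
  imul (fa i) z -> imul (fa i) (iter k (wF1 P2) z).
Proof. by move=> ile Az; elim: k => //= k; apply: imul_fa_F1. Qed.

Lemma iter_F1_semilin k a (x y : wP P2) : imul ka x -> imul ka y ->
  iter k (wF1 P2) (a *: x + y) =
    iter k (fsigma F) a *: iter k (wF1 P2) x + iter k (wF1 P2) y.
Proof.
move=> kx ky; elim: k => //= k ->.
have kk z : imul ka z -> imul ka (iter k (wF1 P2) z).
  by move=> kz; elim: k => //= k; apply: (imul_ker_F1 frF frF' hom alphaI).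
by rewrite window_F1E //; apply/imul_ker_Q/kk.
Qed.

Lemma iter_F1_scale i k a (x : wP P2) : (i <= n)%N -> fa i a ->
  iter k (wF1 P2) (a *: x) = iter k (fsigma1 F) a *: iter k (wF P2) x.
Proof.
move=> ile Aa; elim: k => //= k ->; rewrite window_F1Z //; apply: (fa_I ile).
by elim: k => //= k; apply: fa_sigma1.
Qed.

(** On products, F1^k(a x) = sigma1^k(a) F^k(x), so the nilpotence of sigma1 applies. The induction
    requires all larger exponents to work as well, so that a sum can use the maximum. *)
Lemma F1_nilpotent i (z : wP P2) : (i < n)%N -> imul (fa i) z ->
  exists k, imul (fa i.+1) (iter k (wF1 P2) z).
Proof.
move=> iln Az; have ile := ltnW iln; have [A0 AD AZ] := sfa ile; have [B0 BD BZ] := sfa iln.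
pose W z := imul (fa i) z /\
  exists k, forall k', (k <= k')%N -> imul (fa i.+1) (iter k' (wF1 P2) z).
suff [_ [k kP]] : W z by exists k; apply: kP.
have ik k : iter k (fsigma F) 1 = 1 by elim: k => //= k ->; rewrite rmorph1.
have i0 k : iter k (wF1 P2) 0 = 0.
  by elim: k => //= k ->; rewrite (semilin_on0 sQ (window_F1E P2)).
apply: (ideal_mul_ind (W := W)) Az => [|c t Ac _].
  split.
  - by split=> //; exists 0%N => k _; rewrite i0.
  - move=> x y [Ax [k kP]] [Ay [l lP]]; split; first exact: AD.
    exists (maxn k l) => k'; rewrite geq_max => /andP[kk' lk'].
    rewrite -(scale1r x) iter_F1_semilin; try exact: (imul_fa_ker ile).
    by rewrite ik scale1r; apply: BD; [apply: kP|apply: lP].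
  - move=> s x [Ax [k kP]]; split; first exact: AZ.
    exists k => k' kk'; rewrite -(addr0 (s *: x)) iter_F1_semilin; try exact: (imul_fa_ker ile).
    by rewrite i0 addr0; apply/BZ/kP.
split; first exact: ideal_mul_scale.
have [k kP] := fa_nilp iln Ac.
exists k => k' /subnK <-; rewrite (iter_F1_scale _ _ ile) //; apply: ideal_mul_scale => //.
by rewrite iterD; elim: (k' - k)%N => //= j; apply: fa_sigma1.
Qed.
End Target.

(** * The operator U and the lifting equation *)

Section Hom.
Variables (P1 P2 : window F) (e : wP P1 -> wP P1).
Hypothesis eQ : normal_projection (fI F) (wQ P1) e.
Variables (r : nat) (g : 'I_r -> wP P1) (f : 'I_r -> wP P1 -> S) (C : 'M[S]_r).
Hypothesis db : dual_basis g f.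
Hypothesis hatP : forall m : wP P1 -> wP P2, semilin (fsigma F) m ->
  forall x, hat g f C m (wPsi e x) = m x.
Let el : is_lin e. Proof. by case: eQ. Qed.
Let ff i : functional (f i). Proof. by case: db. Qed.
Let sQ2 := window_Q_submod frF P2.

Definition Psi_along (w : wP P1 -> wP P2) x := wF1 P2 (w (e x)) + wF P2 (w (x - e x)).

Lemma Psi_along_semilin w : is_lin w -> (forall x, e x = x -> wQ P2 (w x)) ->
  semilin (fsigma F) (Psi_along w).
Proof.
move=> wl wQe a x y; have ee z : e (e z) = e z by case: eQ.
rewrite /Psi_along el wl window_F1E; try exact: wQe.
have -> : a *: x + y - (a *: e x + e y) = a *: (x - e x) + (y - e y).
  by rewrite scalerBr opprD addrACA.
by rewrite wl window_FE scalerDr addrACA.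
Qed.

Definition valued i (w : wP P1 -> wP P2) := is_lin w /\ forall x, imul (fa i) (w x).
(** The linear map determined by U(w) Psi = [Psi_along w]; thus w Psi = [Psi_along w] amounts to w =
    U(w). *)
Definition U w := hat g f C (Psi_along w).

Lemma valued_Q i w x : (i <= n)%N -> valued i w -> wQ P2 (w x).
Proof. by move=> ile [_ wv]; apply: imul_ker_Q; apply: (imul_fa_ker ile). Qed.

Lemma U_valued i w : (i <= n)%N -> valued i w -> valued i (U w).
Proof.
move=> ile [wl wv]; split; first exact: hat_lin.
have sA := ideal_mul_is_submod (fa_ideal ile) (fun _ : wP P2 => True).
have [_ AD _] := sA.
by apply: hat_submod => // x; apply: AD; [apply: imul_fa_F1|apply: imul_fa_F_le].
Qed.

Lemma U_Psi i w x : (i <= n)%N -> valued i w -> U w (wPsi e x) = Psi_along w x.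
Proof.
move=> ile wv; apply: hatP; apply: Psi_along_semilin; first by case: wv.
by move=> z _; apply: (valued_Q _ ile).
Qed.

(** Modulo a_{i+1}, U(w)(Psi x) is F1(w(e x)), as F w vanishes there. So F1^k(U w) vanishes on the
    image of Psi when F1^(k+1) w does, hence everywhere since that image spans, and induction
    applies to U(w). *)
Lemma U_nilpotent_step i k w : (i < n)%N -> valued i w ->
  (forall x, imul (fa i.+1) (iter k (wF1 P2) (w x))) -> valued i.+1 (iter k U w).
Proof.
move=> iln; have ile := ltnW iln.
have sB := ideal_mul_is_submod (fa_ideal iln) (fun _ : wP P2 => True).
have [B0 BD BZ] := sB.
elim: k w => [|k IH] w wv wk; first by case: wv.
rewrite iterSr; apply: IH; first exact: U_valued.
have Uv := U_valued ile wv; have [Ul Uv'] := Uv; have [wl wv'] := wv.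
have Uk x := imul_fa_ker ile (Uv' x).
apply: (wPsi_span frF eQ (W := fun x => imul (fa i.+1) (iter k (wF1 P2) (U w x)))).
  have H a x y : imul (fa i.+1) (iter k (wF1 P2) (U w x)) ->
      imul (fa i.+1) (iter k (wF1 P2) (U w y)) ->
      imul (fa i.+1) (iter k (wF1 P2) (U w (a *: x + y))).
    by move=> Hx Hy; rewrite Ul iter_F1_semilin //; apply: BD => //; apply: BZ.
  have H0 : imul (fa i.+1) (iter k (wF1 P2) (U w 0)).
    rewrite (lin0 Ul); have -> : iter k (wF1 P2) 0 = 0 :> wP P2 => //.
    by elim: k {wk H} => //= k ->; rewrite (semilin_on0 sQ2 (window_F1E P2)).
  split=> // [x y Hx Hy|s x Hx]; first by rewrite -(scale1r x); apply: H.
  by rewrite -(addr0 (s *: x)); apply: H.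
move=> x; rewrite (U_Psi _ ile wv) /Psi_along addrC.
have AF : imul (fa i.+1) (wF P2 (w (x - e x))) by apply: imul_fa_F.
rewrite -(scale1r (wF P2 _)) iter_F1_semilin; last 2 first.
- exact: (imul_fa_ker iln).
- by apply: (imul_fa_ker ile); apply: imul_fa_F1.
apply: BD; last by rewrite -iterSr.
by apply: BZ; apply: iter_imul_fa_F1.
Qed.

Lemma U_nilpotent_level i w : (i < n)%N -> valued i w -> exists k, valued i.+1 (iter k U w).
Proof.
move=> iln wv; have [wl wv'] := wv; have ile := ltnW iln.
have [k kP] := choice (fun j : 'I_r => F1_nilpotent iln (wv' (g j))).
(* One exponent must serve for all x: the maximum over the finitely many generators does, by
   semilinearity of F1^K on aP2. *)
pose K := (\max_j k j)%N.
have sB := ideal_mul_is_submod (fa_ideal iln) (fun _ : wP P2 => True).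
have [B0 BD BZ] := sB.
exists K; apply: U_nilpotent_step => // x.
have [_ fg] := db; rewrite (fg x) (lin_sum wl).
suff [] : imul ka (\sum_(j < r) w (f j x *: g j)) /\
  imul (fa i.+1) (iter K (wF1 P2) (\sum_(j < r) w (f j x *: g j))) by [].
have wk j := imul_fa_ker ile (wv' j).
have i0 l : iter l (wF1 P2) 0 = 0 :> wP P2.
  by elim: l => //= l ->; rewrite (semilin_on0 sQ2 (window_F1E P2)).
have [k0 kD kZ] := ideal_mul_is_submod (ker_is_ideal alpha) (fun _ : wP P2 => True).
apply: (big_ind (fun z => imul ka z /\ imul (fa i.+1) (iter K (wF1 P2) z))).
- by rewrite i0.
- move=> y z [ky Hy] [kz Hz]; split; first exact: kD.
  by rewrite -(scale1r y) iter_F1_semilin //; apply: BD => //; apply: BZ.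
- move=> j _; split; first exact: wk.
  rewrite (linZ wl) -(addr0 (_ *: _)) iter_F1_semilin //.
  rewrite i0 addr0; apply: BZ.
  have /subnK <- : (k j <= K)%N by apply: (leq_bigmax j).
  by rewrite iterD; apply: iter_imul_fa_F1.
Qed.

Lemma U_nilpotent w : valued 0 w -> exists k, forall x, iter k U w x = 0.
Proof.
move=> wv.
have H i : (i <= n)%N -> exists k, valued i (iter k U w).
  elim: i => [|i IH] iln; first by exists 0%N.
  have [k kv] := IH (ltnW iln); have [l lv] := U_nilpotent_level iln kv.
  by exists (l + k)%N; rewrite iterD.
have [k [_ kv]] := H n (leqnn n); exists k => x.
apply: (ideal_mul_ind (W := fun z => z = 0)) (kv x) => [|c t /fan -> _]; last by rewrite scale0r.
by split=> // [y z -> ->|s y ->]; rewrite ?addr0 ?scaler0.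
Qed.

(** Uniqueness of lifts: w and U(w) agree on the image of Psi, which spans, so w = U^k(w) = 0 for
    large k. *)
Lemma Psi_fixed_zero w : valued 0 w -> (forall x, w (wPsi e x) = Psi_along w x) ->
  forall x, w x = 0.
Proof.
move=> wv wPsiE; have n0 : (0 <= n)%N by [].
have [wl _] := wv; have [Ul _] := U_valued n0 wv.
have Uw : U w = w.
  apply: funext; apply: (wPsi_span frF eQ (W := fun x => U w x = w x)).
    split; first by rewrite (lin0 Ul) (lin0 wl).
      by move=> x y Ux Uy; rewrite (linD Ul) (linD wl) Ux Uy.
    by move=> s x Ux; rewrite (linZ Ul) (linZ wl) Ux.
  by move=> x; rewrite (U_Psi _ n0 wv) wPsiE.
have iU k : iter k U w = w by elim: k => //= k ->.
by have [k kP] := U_nilpotent wv => x; rewrite -(iU k) kP.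
Qed.

(** The solution is the geometric series of the U^j(h), where h Psi = eta. The partial sums satisfy
    the equation up to U^k(h), which vanishes for large k. *)
Lemma Psi_equation eta : semilin (fsigma F) eta -> (forall x, imul (fa 0%N) (eta x)) ->
  exists2 w, valued 0 w & forall x, w (wPsi e x) = eta x + Psi_along w x.
Proof.
move=> etal etav; have n0 : (0 <= n)%N by [].
have sA := ideal_mul_is_submod (fa_ideal n0) (fun _ : wP P2 => True).
have [A0 AD _] := sA.
pose h := hat g f C eta.
have hv : valued 0 h by split; [exact: hat_lin|exact: hat_submod].
have hk k : valued 0 (iter k U h) by elim: k => //= k; apply: U_valued.
pose s k x := \sum_(j < k) iter j U h x.
have sv k : valued 0 (s k).
  split; last by move=> x; apply: submod_sum => // j _; case: (hk j).
  move=> a x y; rewrite /s scaler_sumr -big_split; apply: eq_bigr => j _ /=.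
  by case: (hk j) => ->.
have sE k x : s k (wPsi e x) + iter k U h (wPsi e x) = eta x + Psi_along (s k) x.
  elim: k => [|k IH].
    rewrite /s /Psi_along !big_ord0 (semilin0 (window_FE P2)).
    by rewrite (semilin_on0 sQ2 (window_F1E P2)) !addr0 add0r; apply: hatP.
  have sS y : s k.+1 y = s k y + iter k U h y by rewrite /s big_ord_recr.
  rewrite sS IH iterS (U_Psi _ n0 (hk k)) -addrA; congr (_ + _).
  rewrite /Psi_along !sS (semilinD (window_FE P2)) (semilin_onD (window_F1E P2)).
  - by rewrite addrACA.
  - exact: (valued_Q _ n0).
  - exact: (valued_Q _ n0).
have [K KP] := U_nilpotent hv.
by exists (s K) => // x; rewrite -sE KP addr0.
Qed.
End Hom.

Lemma window_hat (P1 : window F) e : normal_projection (fI F) (wQ P1) e ->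
  exists r (g : 'I_r -> wP P1) (f : 'I_r -> wP P1 -> S) (C : 'M[S]_r), dual_basis g f /\
    forall (M : lmodType S) (m : wP P1 -> M), semilin (fsigma F) m ->
    forall x, hat g f C m (wPsi e x) = m x.
Proof.
move=> eQ; have [projP _ _ _ _] := wax P1.
have [r [g [f db]]] := fg_projective_dual_basis projP.
have [[I0 _ _] _ rad sX _] := frF.
have prad : jacobson_rad (p%:R : S) by have := rad 0 1 I0; rewrite add0r mulr1.
have [C CP] := semilin_factor p_prime prad sX db (wPsi_semilin frF eQ) (wPsi_span frF eQ).
by exists r, g, f, C.
Qed.

Lemma fully_faithful (P1 P2 : window F) (P1' P2' : window F')
    (u1 : wP P1 -> wP P1') (u2 : wP P2 -> wP P2') (h : wP P1' -> wP P2') :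
  is_ahom alpha u1 -> window_reduction alpha u2 -> is_whom h ->
  exists g : wP P1 -> wP P2, [/\ is_whom g, (forall x, h (u1 x) = u2 (g x)) &
    forall g', is_whom g' -> (forall x, h (u1 x) = u2 (g' x)) -> forall x, g' x = g x].
Proof.
move=> [u1l u1Q u1F u1F1] [u2a u2r u2Q] [hl hQ hF hF1].
have [u2l u2Q' u2F u2F1] := u2a; have [_ u2s u2k] := u2r.
pose v x := h (u1 x).
have vl : semilin alpha v by move=> a x y; rewrite /v u1l hl.
have [e eQ] := window_projection frF P1; have [el ee QE] := eQ.
have Qe x : e x = x -> wQ P1 x by exact: (normal_Q_fix idI eQ).
have [r [g [f [C [db CP]]]]] := window_hat eQ; have [ff fg] := db.
have hatP m := CP (wP P2) m.
have [y yP] := choice (fun i => u2s (v (g i))).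
(* An arbitrary linear lift of [v], obtained by lifting the images of the generators. *)
pose g0 x := \sum_(i < r) f i x *: y i.
have g0l : is_lin g0.
  move=> a x z; rewrite /g0 scaler_sumr -big_split; apply: eq_bigr => i _ /=.
  by rewrite ff scalerDl scalerA.
have g0v x : u2 (g0 x) = v x.
  rewrite (semilin_sum u2l) {2}(fg x) (semilin_sum vl); apply: eq_bigr => i _.
  by rewrite (semilinZ u2l) (semilinZ vl) yP.
have [_ Q2D _] := window_Q_submod frF P2.
(* Q2 contains aP2, so membership in Q2 depends only on the reduction. *)
have liftQ x z : u2 z = v x -> wQ P1 x -> wQ P2 z.
  move=> zx Qx; have [q Qq qE] : exists2 q, wQ P2 q & u2 q = v x.
    by apply: u2Q; apply: hQ; apply: u1Q.
  rewrite -(subrK q z); apply: Q2D => //; apply: imul_ker_Q; apply: u2k.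
  by rewrite (semilinB u2l) zx qE subrr.
have kfa (z : wP P2) : imul ka z -> imul (fa 0%N) z.
  by apply: imul_mono; [exact: fa_ideal|move=> a /fa0].
have Psi_v z : (forall x, u2 (z x) = v x) -> forall x, u2 (Psi_along e z x) = v (wPsi e x).
  move=> zv x; have Qzx : wQ P2 (z (e x)) by apply: liftQ (zv _) _; apply: Qe.
  have Qx : wQ P1 (e x) by apply: Qe.
  rewrite /Psi_along (semilinD u2l) -u2F -u2F1 // !zv /wPsi [in RHS](semilinD vl) /v.
  by rewrite -u1F -u1F1 // hF hF1 //; apply: u1Q.
(* The defect of [g0]. It lies in aP2 because both terms reduce to v(Psi x). *)
pose eta x := g0 (wPsi e x) - Psi_along e g0 x.
have etal : semilin (fsigma F) eta.
  move=> a x z; rewrite /eta (wPsi_semilin frF eQ) g0l.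
  rewrite (Psi_along_semilin eQ g0l); last by move=> t /Qe; apply: liftQ.
  by rewrite scalerBr opprD addrACA.
have etav x : imul (fa 0%N) (eta x).
  by apply/kfa/u2k; rewrite (semilinB u2l) g0v Psi_v // subrr.
have [w wv wE] := Psi_equation eQ db hatP etal etav.
have n0 : (0 <= n)%N by [].
have [wl wv'] := wv.
pose gg x := g0 x - w x.
have ggl : is_lin gg by move=> a x z; rewrite /gg g0l wl scalerBr opprD addrACA.
have ggv x : u2 (gg x) = v x.
  by rewrite (semilinB u2l) g0v (semilin_ker u2l (imul_fa_ker n0 (wv' x))) subr0.
have ggPsi x : gg (wPsi e x) = Psi_along e gg x.
  rewrite /gg wE /eta opprD opprB addrA addrCA subrr addr0 /Psi_along.
  rewrite (semilinB (window_FE P2)) (semilin_onB (window_Q_submod frF P2) (window_F1E P2)).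
  - by rewrite opprD addrACA.
  - by apply: liftQ (g0v _) _; apply: Qe.
  - exact: (valued_Q _ n0 wv).
have ggh : is_whom gg.
  by apply: (whom_of_Psi frF eQ) => // x Qx; apply: liftQ (ggv x) Qx.
exists gg; split=> // g' [g'l g'Q g'F g'F1] g'v x.
have [_ ggQ ggF ggF1] := ggh.
apply/eqP; rewrite -subr_eq0; apply/eqP.
(* Two lifts differ by a map into aP2 that solves the homogeneous equation. *)
apply: (Psi_fixed_zero eQ db hatP (w := fun x => g' x - gg x)).
  split=> [a z t|z]; first by rewrite g'l ggl scalerBr opprD addrACA.
  by apply/kfa/u2k; rewrite (semilinB u2l) -g'v ggv subrr.
move=> z; rewrite /Psi_along.
have Qez : wQ P1 (e z) by apply: Qe.
rewrite (semilinB (window_FE P2)) (semilin_onB (window_Q_submod frF P2) (window_F1E P2));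
  [|exact: g'Q|exact: ggQ].
rewrite g'F1 // ggF1 // g'F ggF /wPsi (linD g'l) (linD ggl).
by rewrite opprD addrACA.
Qed.
End FullyFaithful.

(** * Essential surjectivity *)

(** Approximating the generators by w_i in W gives (1 - C) g = w with C in the radical; 1 - C is
    invertible, so the g_i lie in W. *)
Lemma nakayama_submod (S : comPzRingType) (J : S -> Prop) (P : lmodType S) (W : P -> Prop) :
  is_ideal J -> (forall x, J x -> jacobson_rad x) -> fg_projective P -> is_submod W ->
  (forall x, exists2 w, W w & imul J (x - w)) -> forall x, W x.
Proof.
move=> idJ Jrad /fg_projective_dual_basis[r [g [f [ff fg]]]] sW gen x.
have ex i : exists w, W w /\ imul J (g i - w) by have [y Wy Jy] := gen (g i); exists y.
have [w wP] := choice ex.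
pose C : 'M[S]_r := \matrix_(i, j) f j (g i - w i).
have [D [DC _]] : exists D, D *m (1%:M - C) = 1%:M /\ (1%:M - C) *m D = 1%:M.
  apply: rad_inv_mx => i j; rewrite mxE; apply: Jrad.
  by apply: (imul_functional idJ (ff j)); case: (wP i).
have act1 i : mxact 1%:M g i = g i.
  rewrite /mxact (bigD1 i) //= mxE eqxx scale1r big1 ?addr0 // => j ji.
  by rewrite mxE eq_sym (negPf ji) scale0r.
have Cw : mxact (1%:M - C) g =1 w.
  move=> i; transitivity (mxact 1%:M g i - mxact C g i).
    by rewrite /mxact -sumrB; apply: eq_bigr => j _; rewrite !mxE scalerBl.
  rewrite act1; have -> : mxact C g i = g i - w i.
    by rewrite [RHS]fg; apply: eq_bigr => j _; rewrite mxE.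
  by rewrite opprB addrC subrK.
have [_ _ WZ] := sW; rewrite (fg x); apply: submod_sum => // i _; apply: (WZ).
rewrite -act1 -DC mxactM (eq_mxact _ Cw); apply: submod_sum => // k _; apply: WZ.
by case: (wP k).
Qed.

(** The image is realised as the quotient of P by the kernel of e; its embedding [s] is induced by
    e. *)
Lemma idempotent_image (S : comPzRingType) (P : lmodType S) (e : P -> P) :
  fg_projective P -> is_lin e -> (forall x, e (e x) = e x) ->
  exists (L : lmodType S) (q : P -> L) (s : L -> P), fg_projective L /\
    [/\ is_lin q, is_lin s, (forall y, q (s y) = y) & forall x, s (q x) = e x].
Proof.
move=> /fg_projective_dual_basis[r [g [f [ff fg]]]] el ee.
have [L [q [ql qs qk]]] : exists (L : lmodType S) (q : P -> L),
    [/\ semilin (idfun : {rmorphism S -> S}) q, (forall y, exists x, q x = y) &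
      (forall x, q x = 0 <-> e x = 0)].
  apply: quotient_module => [s|| a x /= ->]; first by exists s.
    split; first exact: (lin0 el).
      by move=> x y ex ey; rewrite (linD el) ex ey addr0.
    by move=> s x ex; rewrite (linZ el) ex scaler0.
  by rewrite scale0r (lin0 el).
have {}ql : is_lin q by [].
have [l lP] := choice qs.
have eE x y : q x = q y -> e x = e y.
  move=> qxy; apply/eqP; rewrite -subr_eq0 -(linB el); apply/eqP/qk.
  by rewrite (linB ql) qxy subrr.
have qe x : q (e x) = q x.
  by apply/eqP; rewrite -subr_eq0 -(linB ql); apply/eqP/qk; rewrite (linB el) ee subrr.
have sl : is_lin (fun y => e (l y)).
  by move=> a y z; rewrite -el; apply: eE; rewrite ql !lP.
exists L, q, (fun y => e (l y)); split; last first.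
  by split=> // [y|x]; [rewrite qe lP|apply: eE; rewrite lP].
apply: (@dual_basis_fg_projective _ _ r (fun i => q (g i)) (fun i y => f i (e (l y)))).
split=> [i a y z|y]; first by rewrite sl ff.
rewrite -{1}(lP y) -qe {1}(fg (e (l y))) (lin_sum ql); apply: eq_bigr => i _.
by rewrite (linZ ql).
Qed.

Lemma pair0r_lin (S : comPzRingType) (L T : lmodType S) :
  is_lin (fun l : L => (l, 0) : (L * T)%type).
Proof.
move=> a u v; change ((a *: u + v, 0) = (a *: u + v, a *: 0 + 0) :> (L * T)%type).
by rewrite scaler0 addr0.
Qed.

Lemma pair0l_lin (S : comPzRingType) (L T : lmodType S) :
  is_lin (fun t : T => (0, t) : (L * T)%type).
Proof.
move=> a u v; change ((0, a *: u + v) = (a *: 0 + 0, a *: u + v) :> (L * T)%type).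
by rewrite scaler0 addr0.
Qed.

Lemma pair_split (S : comPzRingType) (L T : lmodType S) (x : (L * T)%type) :
  x = ((x.1, 0) : (L * T)%type) + (0, x.2).
Proof.
by case: x => l t; change ((l, t) = (l + 0, 0 + t) :> (L * T)%type); rewrite addr0 add0r.
Qed.

Lemma dual_basis_prod (S : comPzRingType) (L T : lmodType S) r1 (g1 : 'I_r1 -> L)
    (f1 : 'I_r1 -> L -> S) r2 (g2 : 'I_r2 -> T) (f2 : 'I_r2 -> T -> S) :
  dual_basis g1 f1 -> dual_basis g2 f2 ->
  dual_basis
    (fun i : 'I_(r1 + r2) => match fintype.split i with
       inl j => (g1 j, 0) | inr j => (0, g2 j) end : (L * T)%type)
    (fun i x => match fintype.split i with inl j => f1 j x.1 | inr j => f2 j x.2 end).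
Proof.
move=> [ff1 fg1] [ff2 fg2]; split=> [i a x y|[x y]].
  by case: fintype.split => j; [exact: ff1|exact: ff2].
rewrite big_split_ord /=.
under eq_bigr => i _ do rewrite -[lshift _ _]/(unsplit (inl i)) unsplitK /=.
under [X in _ = _ + X]eq_bigr => i _ do rewrite -[rshift _ _]/(unsplit (inr i)) unsplitK /=.
rewrite [LHS]pair_split; congr (_ + _) => /=.
  rewrite {1}(fg1 x) (lin_sum (@pair0r_lin S L T)); apply: eq_bigr => i _.
  by rewrite (linZ (@pair0r_lin S L T)).
rewrite {1}(fg2 y) (lin_sum (@pair0l_lin S L T)); apply: eq_bigr => i _.
by rewrite (linZ (@pair0l_lin S L T)).
Qed.

(** * Lifting modules, normal decompositions and windows *)

Section EssentiallySurjective.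
Variables (p : nat) (S S' : comPzRingType) (F : frame S) (F' : frame S').
Variable alpha : {rmorphism S -> S'}.
Hypotheses (frF : is_frame p F) (frF' : is_frame p F') (hom : strict_frame_hom F F' alpha).
Hypothesis alphaI : forall s, fI F' (alpha s) -> fI F s.
Hypothesis alpha_surj : forall s', exists s, alpha s = s'.
Hypothesis lift : forall P' : lmodType S', fg_projective P' ->
  exists (P : lmodType S) (u : P -> P'), projective P /\ is_module_base_change alpha u.

Let idI : is_ideal (fI F). Proof. by case: frF. Qed.
Let idI' : is_ideal (fI F'). Proof. by case: frF'. Qed.
Notation ka := (ker_ideal alpha).
Let idk : is_ideal ka. Proof. exact: ker_is_ideal. Qed.

(** Comparing universal properties with P/aP identifies the kernel of [u]. Generators of P' then
    lift to generators modulo a, and a lies in the radical. *)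
Lemma fg_projective_lift (P' : lmodType S') : fg_projective P' ->
  exists (P : lmodType S) (u : P -> P'), fg_projective P /\ reduction alpha u.
Proof.
move=> fgP'; have [P [u [projP [ul univ]]]] := lift fgP'.
exists P, u.
have sk : is_submod (imul ka : P -> Prop) := ideal_mul_is_submod idk _.
have [M [q [ql qs qk]]] : exists (M : lmodType S') (q : P -> M), [/\ semilin alpha q,
    (forall y, exists x, q x = y) & (forall x, q x = 0 <-> imul ka x)].
  by apply: quotient_module => // a x ax; apply: ideal_mul_scale.
have [l lP] := choice qs.
have [w [wl wu _]] := univ M q ql.
have uE x y : q x = q y -> u x = u y.
  move=> qxy; apply/eqP; rewrite -subr_eq0 -(semilinB ul); apply/eqP.
  by apply: (semilin_ker ul); apply/qk; rewrite (semilinB ql) qxy subrr.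
pose h y := u (l y).
have hl : is_lin h.
  move=> s y z; have [a <-] := alpha_surj s; rewrite /h -ul; apply: uE.
  by rewrite ql !lP.
have [i [_ _ iuniq]] := univ P' u ul.
have hw y : h (w y) = y.
  transitivity (i y); last by apply/esym; apply: (iuniq id).
  apply: (iuniq (h \o w)) => [a x z /=|x /=]; first by rewrite wl hl.
  by rewrite wu; apply: uE; rewrite lP.
have ur : reduction alpha u.
  split=> // [y|x ux]; first by exists (l (w y)); apply: hw.
  by apply/qk; rewrite -wu ux (lin0 wl).
split=> //; split=> //.
have [[r [g' gen]] _] := fgP'; have [_ us uk] := ur.
have [m mP] := choice (fun i => us (g' i)).
apply: (projective_fg_mod_rad (m := m) idk) => // [x|x]; first exact: (ker_rad frF frF' alphaI).
have [c' c'E] := gen (u x); have [c cE] := choice (fun i => alpha_surj (c' i)).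
exists c; apply: uk; rewrite (semilinB ul) c'E (semilin_sum ul); apply/eqP; rewrite subr_eq0.
by apply/eqP/eq_bigr => j _; rewrite (semilinZ ul) mP cE.
Qed.

(** The images of e' and 1 - e' are lifted separately; on the product of the lifts, the first
    projection lifts e'. *)
Lemma normal_lift (P' : lmodType S') (e' : P' -> P') :
  fg_projective P' -> is_lin e' -> (forall x, e' (e' x) = e' x) ->
  exists (P : lmodType S) (u : P -> P') (e : P -> P), [/\ fg_projective P, reduction alpha u,
    is_lin e, (forall x, e (e x) = e x) & forall x, u (e x) = e' (u x)].
Proof.
move=> fgP' e'l e'e.
have c'l : is_lin (fun x => x - e' x).
  by move=> a x y; rewrite e'l scalerBr opprD addrACA.
have c'e x : (x - e' x) - e' (x - e' x) = x - e' x by rewrite (linB e'l) e'e subrr subr0.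
have [L' [qL [sL [fgL' [qLl sLl qsL sqL]]]]] := idempotent_image fgP' e'l e'e.
have [T' [qT [sT [fgT' [qTl sTl qsT sqT]]]]] := idempotent_image fgP' c'l c'e.
have [L [uL [fgL [uLl uLs uLk]]]] := fg_projective_lift fgL'.
have [T [uT [fgT [uTl uTs uTk]]]] := fg_projective_lift fgT'.
pose u (x : (L * T)%type) := sL (uL x.1) + sT (uT x.2).
pose e (x : (L * T)%type) : (L * T)%type := (x.1, 0).
have e'sL z : e' (sL z) = sL z by rewrite -sqL qsL.
have e'sT z : e' (sT z) = 0.
  by rewrite -[z]qsT sqT (linB e'l) e'e subrr.
have ul : semilin alpha u.
  by move=> a x y; rewrite /u /= uLl uTl sLl sTl scalerDr addrACA.
have ue x : u (e x) = e' (u x).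
  by rewrite /u /e /= (semilin0 uTl) (lin0 sTl) addr0 (linD e'l) e'sL e'sT addr0.
exists (L * T)%type, u, e; split=> //.
- have [r1 [g1 [f1 db1]]] := fg_projective_dual_basis fgL.
  have [r2 [g2 [f2 db2]]] := fg_projective_dual_basis fgT.
  exact: dual_basis_fg_projective (dual_basis_prod db1 db2).
- split=> // [y|x ux].
    have [l lE] := uLs (qL y); have [t tE] := uTs (qT y); exists (l, t).
    by rewrite /u /= lE tE sqL sqT addrC subrK.
  have uL0 : sL (uL x.1) = 0.
    by have := ue x; rewrite ux (lin0 e'l) /u /e /= (semilin0 uTl) (lin0 sTl) addr0.
  have uT0 : sT (uT x.2) = 0 by move: ux; rewrite /u uL0 add0r.
  have kL : imul ka x.1 by apply: uLk; rewrite -[LHS]qsL uL0 (lin0 qLl).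
  have kT : imul ka x.2 by apply: uTk; rewrite -[LHS]qsT uT0 (lin0 qTl).
  have [_ kD _] := ideal_mul_is_submod idk (fun _ : (L * T)%type => True).
  rewrite (pair_split x).
  apply: kD; first exact: (imul_lin idk (@pair0r_lin S L T)).
  exact: (imul_lin idk (@pair0l_lin S L T)).
- by move=> a x y; exact: pair0r_lin.
Qed.

Lemma window_lift (P' : window F') :
  exists (P : window F) (u : wP P -> wP P'), window_reduction alpha u.
Proof.
have [hI hs hs1] := hom.
have [_ [s1D s1Z] _ _ genI] := frF; have [I0 ID IM] := idI.
have [fgP' _ _ _ _] := wax P'.
have [e' eQ'] := window_projection frF' P'; have [e'l e'e QE'] := eQ'.
have [P [u [e [fgP ur el ee ue]]]] := normal_lift fgP' e'l e'e.
have [ul us uk] := ur.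
have [r [g [f db]]] := fg_projective_dual_basis fgP; have [ff fg] := db.
have [theta [thetaE thetaP]] := frame_theta frF frF' hom.
pose Psi' := wPsi e'; have Psi'l : semilin (fsigma F') Psi' := wPsi_semilin frF' eQ'.
have [Psi Psil uPsi] : exists2 Psi, semilin (fsigma F) Psi & forall x, u (Psi x) = Psi' (u x).
  have [y yP] := choice (fun i => us (Psi' (u (g i)))).
  exists (fun x => \sum_(i < r) fsigma F (f i x) *: y i) => [a x z|x].
    rewrite scaler_sumr -big_split; apply: eq_bigr => i _ /=.
    by rewrite ff rmorphD rmorphM scalerDl scalerA.
  rewrite (semilin_sum ul) {2}(fg x) (semilin_sum ul) (semilin_sum Psi'l).
  by apply: eq_bigr => i _; rewrite !(semilinZ ul) (semilinZ Psi'l) yP hs.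
pose Q x := imul (fI F) (x - e x).
have eQ : normal_projection (fI F) Q e by split.
(* On T, F is Psi; on L it has to be theta F1, that is, theta Psi. *)
pose Fw x := theta *: Psi (e x) + Psi (x - e x).
(* On IT, a sum of a_i t_i must go to the sum of sigma1(a_i) Psi(t_i). The coordinates of x - e x,
   which lie in I for x in Q, provide one such expression for each x, so the formula is well
   defined. *)
pose F1 x := Psi (e x) +
  \sum_(i < r) fsigma1 F (f i (x - e x)) *: Psi (g i - e (g i)).
have ex0 x : e (x - e x) = 0 := normal_compl eQ x.
have cl : is_lin (fun x => x - e x).
  by move=> a x z; rewrite el scalerBr opprD addrACA.
have cz z : z - e z = \sum_(i < r) f i z *: (g i - e (g i)).
  rewrite {1 2}(fg z) (lin_sum cl).
  by apply: eq_bigr => i _; rewrite (linZ cl).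
have cE x : x - e x = \sum_(i < r) f i (x - e x) *: (g i - e (g i)).
  by rewrite -cz ex0 subr0.
have fI_Q x i : Q x -> fI F (f i (x - e x)) by apply: (imul_functional idI (ff i)).
have Fl : semilin (fsigma F) Fw.
  by move=> a x z; rewrite /Fw cl el !Psil !scalerDr addrACA !scalerA (mulrC theta).
have F1l : semilin_on (fsigma F) Q F1.
  move=> a x z Qx Qz; rewrite /F1 cl el Psil [in RHS]scalerDr [in RHS]addrACA; congr (_ + _).
  rewrite scaler_sumr -big_split; apply: eq_bigr => i _ /=.
  have Ix := fI_Q x i Qx; have Iz := fI_Q z i Qz.
  by rewrite ff s1D ?s1Z ?scalerDl ?scalerA //; apply: IM.
have F1a a x : fI F a -> F1 (a *: x) = fsigma1 F a *: Fw x.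
  move=> Ia; rewrite /F1 /Fw scalerDr (linZ cl) (linZ el) (semilinZ Psil) scalerA.
  rewrite thetaE // (mulrC theta).
  congr (_ + _); rewrite [X in Psi X](cE x) (semilin_sum Psil) scaler_sumr.
  apply: eq_bigr => i _; rewrite (semilinZ Psil) scalerA (functionalZ (ff i)) (mulrC a) s1Z //.
  by rewrite mulrC.
have s10 : fsigma1 F 0 = 0 by have := s1Z 0 0 I0; rewrite mulr0 rmorph0 mul0r.
have Psi'e x : Psi' (u (e x)) = wF1 P' (e' (u x)).
  by rewrite ue /Psi' (wPsi_fix (e'e _)).
have Psi'c x : Psi' (u (x - e x)) = wF P' (u x - e' (u x)).
  by rewrite (semilinB ul) ue /Psi' (wPsi_compl frF' (normal_compl eQ' _)).
have uF x : wF P' (u x) = u (Fw x).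
  rewrite /Fw (semilinD ul) (semilinZ ul) !uPsi Psi'e Psi'c -thetaP.
    by rewrite -(semilinD (window_FE P')) addrC subrK.
  exact: (normal_Q_fix idI' eQ').
have QQ x : wQ P' (u x) <-> Q x.
  rewrite QE' -ue -(semilinB ul); exact: (reduction_imul frF frF' hom alphaI alpha_surj).
have sQ' := window_Q_submod frF' P'.
have uF1 x : Q x -> wF1 P' (u x) = u (F1 x).
  move=> Qx; rewrite /F1 (semilinD ul) uPsi Psi'e (semilin_sum ul).
  have Qe' : wQ P' (e' (u x)) := normal_Q_fix idI' eQ' (e'e _).
  pose t i := alpha (f i (x - e x)) *: (u (g i - e (g i))).
  have It i : fI F' (alpha (f i (x - e x))) by apply/hI/fI_Q.
  have Qt i : wQ P' (t i).
    by apply: (window_imul_Q frF'); apply: ideal_mul_scale.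
  have -> : \sum_(i < r) u (fsigma1 F (f i (x - e x)) *: Psi (g i - e (g i))) =
      \sum_(i < r) wF1 P' (t i).
    apply: eq_bigr => i _; rewrite (semilinZ ul) uPsi Psi'c window_F1Z // -hs1; last exact: fI_Q.
    by rewrite (semilinB ul) ue.
  have Qs : wQ P' (\sum_(i < r) t i) by apply: submod_sum.
  rewrite -(semilin_on_sum sQ' (window_F1E P')) // -(semilin_onD (window_F1E P')) //.
  congr wF1; rewrite -[LHS](subrK (e' (u x))) addrC; congr (_ + _).
  rewrite -ue -(semilinB ul) (cE x) (semilin_sum ul).
  by apply: eq_bigr => i _; rewrite (semilinZ ul).
have axP : window_axioms F Q Fw F1.
  split=> //; first exact: projection_normal_decomposition eQ.
  pose W z := @combination _ P P F1 (fun (_ : S) q => Q q) z.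
  have sW : is_submod W by apply: combination_submod.
  have [W0 WD WZ] := sW.
  have WF1 q : Q q -> W (F1 q).
    by move=> Qq; rewrite -[F1 q]scale1r; apply: (combination1 F1 (A := fun (_ : S) q => Q q)).
  have WPsi x : W (Psi x).
    rewrite -(subrK (e x) x) (semilinD Psil); apply: (WD).
      (* On T, sigma1(a) Psi(t) = F1(a t) lies in W, and the sigma1(a) generate the unit ideal. *)
      have [n [c [a [Ia e1]]]] := genI 1.
      rewrite -[Psi _]scale1r e1 scaler_suml; apply: submod_sum => // i _; rewrite -scalerA.
      apply: (WZ); have -> : Psi (x - e x) = Fw (x - e x).
        by rewrite /Fw ex0 (semilin0 Psil) scaler0 add0r subr0.
      rewrite -F1a //; apply: WF1; apply: (imul_normal_Q idI eQ).
      exact: ideal_mul_scale.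
    have -> : Psi (e x) = F1 (e x).
      rewrite /F1 ee subrr big1 ?addr0 // => i _.
      by rewrite (functional0 (ff i)) s10 scale0r.
    by apply: WF1; rewrite /Q ee subrr; case: (ideal_mul_is_submod idI (fun _ : P => True)).
  (* It suffices that W maps onto P' = P/aP: its image contains that of Psi', which spans. *)
  apply: (nakayama_submod idk (ker_rad frF frF' alphaI) fgP sW) => x.
  suff [z Wz zx] : exists2 z, W z & u z = u x.
    by exists z => //; apply: uk; rewrite (semilinB ul) zx subrr.
  apply: (wPsi_span frF' eQ' (W := fun y => exists2 z, W z & u z = y)).
    split; first by exists 0; rewrite ?(semilin0 ul).
      move=> _ _ [z Wz <-] [t Wt <-]; exists (z + t); last by rewrite (semilinD ul).
      exact: WD.
    move=> s _ [z Wz <-]; have [a <-] := alpha_surj s; exists (a *: z).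
      exact: WZ.
    by rewrite (semilinZ ul).
  by move=> v; have [z <-] := us v; exists (Psi z).
exists (Window axP), u; split=> //; first by split=> // x /QQ.
by move=> v; have [z <-] := us v => /QQ Qz; exists z.
Qed.
End EssentiallySurjective.

Theorem theorem3p2 (p : nat) (S S' : comPzRingType) (F : frame S) (F' : frame S')
  (alpha : {rmorphism S -> S'}) (n : nat) (fa : nat -> S -> Prop) :
  prime p -> is_frame p F -> is_frame p F' ->
  strict_frame_hom F F' alpha ->
  (* alpha induces an isomorphism R = S/I -> R' = S'/I' *)
  (forall s', exists s, fI F' (s' - alpha s)) ->
  (forall s, fI F' (alpha s) -> fI F s) ->
  (* S -> S' is surjective, with kernel fa 0 *)
  (forall s', exists s, alpha s = s') ->
  (forall x, fa 0%N x <-> alpha x = 0) ->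
  (* finite filtration by ideals *)
  (forall i, (i <= n)%N -> is_ideal (fa i)) ->
  (forall i x, (i < n)%N -> fa i.+1 x -> fa i x) ->
  (forall x, fa n x <-> x = 0) ->
  (forall i x, (i < n)%N -> fa i x -> fa i.+1 (fsigma F x)) ->
  (forall i x, (i <= n)%N -> fa i x -> fa i (fsigma1 F x)) ->
  (* sigma1 elementwise nilpotent on fa i / fa (i+1) *)
  (forall i x, (i < n)%N -> fa i x -> exists k, fa i.+1 (iter k (fsigma1 F) x)) ->
  (* f.g. projective S'-modules lift to projective S-modules *)
  (forall P' : lmodType S', fg_projective P' ->
     exists (P : lmodType S) (u : P -> P'), projective P /\ is_module_base_change alpha u) ->
  crystalline F F' alpha.
Proof.
move=> p_prime frF frF' hom _ alphaI alpha_surj fa0 fa_ideal fa_dec fan fa_sigma fa_sigma1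
  fa_nilp lift; split.
  move=> P1 P2 P1' P2' u1 u2 [u1a _] u2b h hh.
  have u2r := base_change_window_reduction frF frF' hom alphaI alpha_surj u2b.
  exact: (fully_faithful p_prime frF frF' hom alphaI fa0 fa_ideal fa_dec fan fa_sigma
    fa_sigma1 fa_nilp).
move=> P'; have [P [u ur]] := window_lift frF frF' hom alphaI alpha_surj lift P'.
exists P, P', u; split; first exact: window_reduction_base_change.
by exists id, id; split.
Qed.
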